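(* Let $X$ be a Banach space and $G$ a compact topological group acting on $X$. Then $X$ is $G$-reflexive if, and only if, every $G$-invariant functional $f\in X_G^*$ is norm-attaining.
   Context: $X$ is a Banach space over $\mathbb{K}=\mathbb{R}$ or $\mathbb{C}$. A compact topological group $G$ acting on $X$ means: a group $G\subseteq\mathcal{L}(X)$ of linear isometric isomorphisms of $X$ onto itself, compact for the relative topology inherited from $\mathcal{L}(X)$. $X_G=\{x\in X: g(x)=x\ \forall g\in G\}$; $X_G^*=\{f\in X^*: f(g(x))=f(x)\ \forall x\in X, g\in G\}$; $X^{**}_{G^{**}}=\{x^{**}\in X^{**}: g^{**}(x^{**})=x^{**}\ \forall g\in G\}$. $X$ is $G$-reflexive if $\pi(X_G)=X^{**}_{G^{**}}$, where $\pi:X\to X^{**}$ is the canonical injection. A functional $f\in X^*$ is norm-attaining if there is $x\in X$ with $\|x\|=1$ and $f(x)=\|f\|$. *)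

(* Defs.v *)
From HB Require Import structures.
From mathcomp Require Import all_boot all_order all_algebra.
From mathcomp Require Import all_classical all_reals all_analysis.
From mathcomp Require Import complex.
Set Implicit Arguments.
Unset Strict Implicit.
Unset Printing Implicit Defensive.
Import Order.TTheory GRing.Theory Num.Theory.
Import numFieldNormedType.Exports.
Local Open Scope classical_set_scope.
Local Open Scope ring_scope.

(* Norms of a normedModType K take their values in K itself, so an operator
   norm is a supremum in K.  This interface isolates what is needed for it to
   exist; it is instantiated below by every R : realType and by R[i], and it
   makes it possible to define operator norms for both fields at once. *)
HB.mixin Record NumField_hasNonnegSup K & Num.NumField K := {
  nonneg_supremums : forall A : set K, A !=set0 -> ubound A !=set0 ->
    (forall a, A a -> 0 <= a) -> supremums A !=set0
}.

#[short(type="scalarFieldType")]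
HB.structure Definition ScalarField :=
  {K of Num.NumField K & NumField_hasNonnegSup K}.

Section real_scalars.
Variable R : realType.

Lemma real_nonneg_supremums (A : set R) : A !=set0 -> ubound A !=set0 ->
  (forall a, A a -> 0 <= a) -> supremums A !=set0.
Proof.
move=> A0 uA _; exists (sup A); split; first exact: sup_upper_bound.
by move=> b ub; apply: ge_sup.
Qed.

Local Open Scope complex_scope.

Lemma complex_nonneg_supremums (A : set R[i]) : A !=set0 -> ubound A !=set0 ->
  (forall a, A a -> 0 <= a) -> supremums A !=set0.
Proof.
move=> [a0 Aa0] [M uM] A_ge0.
have ReE z : 0 <= z -> z = (complex.Re z)%:C.
  by case: z => x y; rewrite lecE /= => /andP[/eqP -> _].
have AE a : A a -> a = (complex.Re a)%:C by move/A_ge0/ReE.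
have uE b : ubound A b -> b = (complex.Re b)%:C.
  by move=> ub; apply: ReE; apply: le_trans (ub _ Aa0); exact: A_ge0.
pose B := [set complex.Re a | a in A].
have B0 : B !=set0 by exists (complex.Re a0), a0.
have uB b : ubound A b -> ubound B (complex.Re b).
  move=> ub _ [a Aa <-]; have := ub _ Aa.
  by rewrite (AE _ Aa) (uE _ ub) lecR.
exists (sup B)%:C; split.
  move=> a Aa; rewrite (AE _ Aa) lecR; apply: sup_upper_bound.
    by split=> //; exists (complex.Re M); exact: uB.
  by exists a.
by move=> b ub; rewrite (uE _ ub) lecR; apply: ge_sup => //; exact: uB.
Qed.

End real_scalars.

HB.instance Definition _ (R : realType) :=
  NumField_hasNonnegSup.Build R (@real_nonneg_supremums R).
HB.instance Definition _ (R : realType) :=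
  NumField_hasNonnegSup.Build R[i]%C (@complex_nonneg_supremums R).

Section bounded_linear.
Variables (K : scalarFieldType) (X Y : normedModType K).

Definition bounded_linear : {pred X -> Y} :=
  fun f => `[< linear f /\ continuous f >].

Record boundedLinear := BoundedLinear {
  bl_fun :> X -> Y;
  bl_funP : bl_fun \in bounded_linear
}.

HB.instance Definition _ := [isSub for bl_fun].
HB.instance Definition _ := [Choice of boundedLinear by <:].

Lemma bounded_linearP (f : X -> Y) :
  reflect (linear f /\ continuous f) (f \in bounded_linear).
Proof. exact: asboolP. Qed.

Lemma bounded_linear_submod_closed : submod_closed bounded_linear.
Proof.
split.
  apply/bounded_linearP; split; last exact: cst_continuous.
  by move=> k x y; rewrite scaler0 addr0.
move=> k f g /bounded_linearP[lf cf] /bounded_linearP[lg cg].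
apply/bounded_linearP; split.
  move=> a x y; rewrite !fctE.
  by rewrite lf lg !scalerDr !scalerA (mulrC k) addrACA.
move=> x; apply: (@continuousD K Y X); last exact: cg.
by apply: continuousZr; exact: cf.
Qed.

HB.instance Definition _ := GRing.isSubmodClosed.Build K (X -> Y)
  bounded_linear bounded_linear_submod_closed.
HB.instance Definition _ := [SubChoice_isSubLmodule of boundedLinear by <:].

Lemma bl_linear (f : boundedLinear) : linear f.
Proof. by have /bounded_linearP[] := bl_funP f. Qed.

HB.instance Definition _ (f : boundedLinear) :=
  GRing.isLinear.Build K X Y *:%R f (@bl_linear f).

Lemma bl_continuous (f : boundedLinear) : continuous f.
Proof. by have /bounded_linearP[] := bl_funP f. Qed.

Lemma bound_bounded_linear (f : X -> Y) (M : K) : linear f -> 0 <= M ->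
  (forall x, `|f x| <= M * `|x|) -> f \in bounded_linear.
Proof.
move=> lf M0 fM; apply/bounded_linearP; split=> //.
pose F : {linear X -> Y} := HB.pack f (GRing.isLinear.Build K X Y *:%R f lf).
apply: (@bounded_linear_continuous K X Y F); apply/bounded_funP => r.
exists (M * r) => x xr; apply: le_trans (fM x) _.
exact: ler_wpM2l.
Qed.

Definition opnorm (f : boundedLinear) : K :=
  supremum 0 [set `|f x| | x in [set x | `|x| <= 1]].

Lemma opnorm_supremums (f : boundedLinear) :
  supremums [set `|f x| | x in [set x | `|x| <= 1]] (opnorm f).
Proof.
set A := (X in supremums X).
have A0 : A !=set0 by exists `|f 0|, 0 => //=; rewrite normr0 ler01.
rewrite /opnorm /supremum ifF; last by apply/negbTE/set0P.
apply: xgetPex; apply: nonneg_supremums => //; last by move=> _ [x _ <-].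
have /bounded_funP/(_ 1)[M fM] : bounded_near f (nbhs (0 : X)).
  by apply/linear_bounded_continuous; exact: bl_continuous.
by exists M => _ [x /= x1 <-]; exact: fM.
Qed.

Lemma opnorm_ge0 (f : boundedLinear) : 0 <= opnorm f.
Proof.
have [ub _] := opnorm_supremums f; apply: le_trans (ub `|f 0| _) => //.
by exists 0 => //=; rewrite normr0 ler01.
Qed.

Lemma ler_opnorm (f : boundedLinear) (x : X) : `|f x| <= opnorm f * `|x|.
Proof.
have [->|x0] := eqVneq x 0; first by rewrite linear0 !normr0 mulr0.
have nx : 0 < `|x| by rewrite normr_gt0.
rewrite -ler_pdivrMr//; have [ub _] := opnorm_supremums f.
have := ub `|f (`|x|^-1 *: x)|; rewrite linearZ/= normrZ normfV normr_id mulrC.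
apply; exists (`|x|^-1 *: x); last by rewrite linearZ/= normrZ normfV normr_id mulrC.
by rewrite /= normrZ normfV normr_id mulVf ?gt_eqF.
Qed.

Lemma opnorm_le (f : boundedLinear) (M : K) : 0 <= M ->
  (forall x, `|f x| <= M * `|x|) -> opnorm f <= M.
Proof.
move=> M0 fM; have [_ lb] := opnorm_supremums f; apply: lb => _ [x /= x1 <-].
by apply: le_trans (fM x) _; rewrite ler_piMr.
Qed.

Lemma opnormD (f g : boundedLinear) : opnorm (f + g) <= opnorm f + opnorm g.
Proof.
apply: opnorm_le => [|x]; first by rewrite addr_ge0 ?opnorm_ge0.
by rewrite mulrDl; apply: le_trans (ler_normD _ _) (lerD _ _); exact: ler_opnorm.
Qed.

Lemma opnormZ (k : K) (f : boundedLinear) : opnorm (k *: f) = `|k| * opnorm f.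
Proof.
have le (a : K) (h : boundedLinear) : opnorm (a *: h) <= `|a| * opnorm h.
  apply: opnorm_le => [|x]; first by rewrite mulr_ge0 ?opnorm_ge0.
  by rewrite [leLHS]normrZ -mulrA ler_wpM2l// ler_opnorm.
apply/le_anti; rewrite le/=.
have [->|k0] := eqVneq k 0; first by rewrite normr0 mul0r opnorm_ge0.
rewrite -ler_pdivlMl ?normr_gt0// -normfV.
by apply: le_trans (le _ _); rewrite scalerA mulVf// scale1r.
Qed.

Lemma opnorm_eq0 (f : boundedLinear) : opnorm f = 0 -> f = 0.
Proof.
move=> f0; apply/val_inj/funext => x /=; apply/eqP; rewrite -normr_le0.
by apply: le_trans (ler_opnorm f x) _; rewrite f0 mul0r.
Qed.

HB.instance Definition _ := @Lmodule_isNormed.Build K boundedLinear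
  opnorm opnormD opnormZ opnorm_eq0.

Lemma bl_normE (f : boundedLinear) :
  `|f| = supremum 0 [set `|f x| | x in [set x | `|x| <= 1]].
Proof. by []. Qed.

Lemma ler_bl_norm (f : boundedLinear) (x : X) : `|f x| <= `|f| * `|x|.
Proof. exact: ler_opnorm. Qed.

End bounded_linear.

Section operators.
Variable K : scalarFieldType.
Implicit Types X Y Z : normedModType K.

Lemma bl_id_subproof X : (@id X) \in @bounded_linear K X X.
Proof. by apply/bounded_linearP; split=> // x; exact: cvg_id. Qed.
Definition bl_id X : boundedLinear X X := BoundedLinear (bl_id_subproof X).

Lemma bl_comp_subproof X Y Z (g : boundedLinear Y Z) (f : boundedLinear X Y) :
  g \o f \in @bounded_linear K X Z.
Proof.
apply/bounded_linearP; split; first by move=> k x y; rewrite /= !linearP.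
by move=> x; apply: continuous_comp; exact: bl_continuous.
Qed.
Definition bl_comp X Y Z (g : boundedLinear Y Z) (f : boundedLinear X Y) :
  boundedLinear X Z := BoundedLinear (bl_comp_subproof g f).

Definition dual X : normedModType K := boundedLinear X K^o.

Lemma adjoint_subproof X Y (g : boundedLinear X Y) :
  (fun f : dual Y => bl_comp f g : dual X)
    \in @bounded_linear K (dual Y) (dual X).
Proof.
apply: (@bound_bounded_linear _ _ _ _ `|g|) => // [k f h|f].
  exact/val_inj/funext.
apply: opnorm_le => [|x]; first by rewrite mulr_ge0.
apply: le_trans (ler_bl_norm f (g x)) _.
by rewrite [_ * `|f|]mulrC -mulrA ler_wpM2l// ler_bl_norm.
Qed.
Definition adjoint X Y (g : boundedLinear X Y) :
  boundedLinear (dual Y) (dual X) := BoundedLinear (adjoint_subproof g).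

Lemma bidual_embedding_subproof X (x : X) :
  (fun f : dual X => f x) \in @bounded_linear K (dual X) K^o.
Proof.
apply: (@bound_bounded_linear _ _ _ _ `|x|) => // f.
by rewrite mulrC; exact: ler_bl_norm.
Qed.
Definition bidual_embedding X (x : X) : dual (dual X) :=
  BoundedLinear (bidual_embedding_subproof x).

(* [compact G] refers to the operator norm topology of [boundedLinear X X];
   compactness of a subset is compactness for its relative topology. *)
Record compact_isometry_group X (G : set (boundedLinear X X)) : Prop := {
  group_isometry : forall g, G g -> forall x, `|g x| = `|x|;
  group_bijective : forall g, G g -> bijective g;
  group_id : G (bl_id X);
  group_comp : forall g h, G g -> G h -> G (bl_comp g h);
  group_inv : forall g, G g ->
    exists2 h, G h & bl_comp g h = bl_id X /\ bl_comp h g = bl_id X;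
  group_compact : compact G
}.

Definition invariants X (G : set (boundedLinear X X)) : set X :=
  [set x | forall g, G g -> g x = x].

Definition dual_invariants X (G : set (boundedLinear X X)) : set (dual X) :=
  [set f | forall x g, G g -> f (g x) = f x].

Definition bidual_invariants X (G : set (boundedLinear X X)) :
    set (dual (dual X)) :=
  [set F | forall g, G g -> adjoint (adjoint g) F = F].

Definition group_reflexive X (G : set (boundedLinear X X)) : Prop :=
  @bidual_embedding X @` invariants G = bidual_invariants G.

Definition norm_attaining X (f : dual X) : Prop :=
  exists x : X, `|x| = 1 /\ f x = `|f|.

End operators.

(* Main.v *)
(* Averaging over the compact group gives a contraction P of X onto X_G, a limit of
   convex combinations of G, with f o P = f for f in X_G^* and F(f o P) = F(f) for
   G-invariant F in X^{**}.  The theorem thus becomes James' theorem for the real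
   seminorm x |-> |P x|, whose bounded functionals are exactly the real parts of
   the G-invariant functionals.

   P: if T is in the convex hull of G and all the gTh are within r of each other,
   averaging the g_i T g_j over a finite e-net (g_i) of G replaces r by
   r - (r - 2e)/m, with m depending on the net only; hence the hull contains T
   with gTh arbitrarily close to T for all g, h, and any two such T, T' are both
   close to TT'.

   James' theorem: if F is at positive distance from the evaluations, a minimax
   argument yields points x_k of the ball such that, for every n, some functional
   of the dual ball is <= d at x_k for k < n and >= th at x_k for large k, where
   d < th.  Such functionals form decreasing convex sets T_n.  As in James' 1972
   proof one picks g_n in T_n, the later ones from shrinking convex sets, so that
   u = sum_n k^n (1 - k) g_n nearly minimizes sup_y limsup_m (u - g_m)(y).  With w
   the limit of g_n along an ultrafilter, u - w does not attain its norm: at each y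
   of the ball some n has g_n(y) <= w(y) + k, and for small k the later terms
   cannot make up for the loss at this single index. *)
Require Import Defs.
From mathcomp Require Import all_boot all_order all_algebra.
From mathcomp Require Import all_classical all_reals all_analysis.
From mathcomp Require Import complex.
From HB Require Import structures.
From mathcomp Require Import finmap ring lra.
Set Implicit Arguments.
Unset Strict Implicit.
Unset Printing Implicit Defensive.
Import Order.TTheory GRing.Theory Num.Theory.
Import numFieldNormedType.Exports.
Local Open Scope classical_set_scope.
Local Open Scope ring_scope.

(** * Minimax and Hahn-Banach *)

Section helly.
Variables (R : realType).

Definition cvx (E : lmodType R) (K : set E) :=
  forall x y t, K x -> K y -> 0 <= t <= 1 -> K (t *: x + (1 - t) *: y).

Definition affine_on (E : lmodType R) (K : set E) (f : E -> R) :=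
  forall x y t, K x -> K y -> 0 <= t <= 1 ->
    f (t *: x + (1 - t) *: y) = t * f x + (1 - t) * f y.

(** The pair [(f, g)] maps [K] onto a convex subset of the plane that misses the open positive
    quadrant; [t] comes from a line separating the two. *)
Lemma affine_alternative (E : lmodType R) (K : set E) (f g : E -> R) :
  cvx K -> affine_on K f -> affine_on K g ->
  (forall x, K x -> 0 < f x -> g x <= 0) ->
  exists2 t, 0 <= t <= 1 & forall x, K x -> t * g x + (1 - t) * f x <= 0.
Proof.
move=> cK af ag fg.
have [[x0 [Kx0 fx0]]|fle0] := pselect (exists x, K x /\ 0 < f x); last first.
  exists 0; first by rewrite lexx ler01.
  move=> x Kx; rewrite mul0r add0r subr0 mul1r leNgt; apply/negP => fx.
  by apply: fle0; exists x.
(* Where [0 < f x], the claim reads [f x / (f x - g x) <= t], so the least candidate for [t] is the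
   supremum of these quotients. *)
pose A := [set f x / (f x - g x) | x in [set x | K x /\ 0 < f x]].
have A1 : ubound A 1.
  move=> _ [x [Kx fx] <-]; have gx := fg x Kx fx.
  by rewrite ler_pdivrMr; lra.
have hA : has_sup A by split; [exists (f x0 / (f x0 - g x0)), x0|exists 1].
have A0 : 0 <= sup A.
  apply: le_trans (sup_upper_bound hA _); last by exists x0.
  by have gx := fg x0 Kx0 fx0; rewrite divr_ge0//; lra.
have A1' : sup A <= 1 by apply: ge_sup => //; case: hA.
exists (sup A); first by rewrite A0.
move=> x Kx; move: (sup A) A0 A1' (@sup_upper_bound _ A hA)
  (fun e e0 => @sup_adherent _ A e e0 hA) => r r0 r1 rub radh.
rewrite leNgt; apply/negP => pos.
have [fx|fx] := ltP 0 (f x).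
  have gx := fg x Kx fx.
  have : f x / (f x - g x) <= r by apply: rub; exists x.
  by rewrite ler_pdivrMr; nra.
have gx : 0 < g x by nra.
(* A violation at [x] puts the quotient of [x] strictly below the supremum, so some [y] with
   [0 < f y] has a larger one. *)
have : - f x / (g x - f x) < r by rewrite ltr_pdivrMr; nra.
rewrite -subr_gt0 => /radh[_ [y [Ky fy] <-]].
have gy := fg y Ky fy.
rewrite opprB addrC subrK ltr_pdivrMr; last lra.
rewrite mulrAC ltr_pdivlMr; last lra.
move=> H.
have ac : f x * g y < g x * f y by nra.
pose a := f y; pose b := - g y; pose c := g x; pose d := - f x.
(* With this weight [f] and [g] agree at [z]; their common value [(a * c - b * d) / (a + b + c + d)]
   is positive by [ac]. *)
pose t := (c + d) / (a + b + c + d).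
have t01 : 0 <= t <= 1.
  by rewrite divr_ge0 ?ler_pdivrMr /a /b /c /d; lra.
pose z := t *: y + (1 - t) *: x.
have den : 0 < a + b + c + d by rewrite /a /b /c /d; lra.
have t1 : 1 - t = (a + b) / (a + b + c + d).
  by rewrite /t; field; rewrite gt_eqF.
have fz : 0 < f z.
  rewrite af// t1 /t ![_ / _ * _]mulrAC -mulrDl divr_gt0//.
  by rewrite /a /b /c /d; nra.
have := fg z (cK _ _ _ Ky Kx t01) fz; rewrite leNgt => /negP; apply.
rewrite ag// t1 /t ![_ / _ * _]mulrAC -mulrDl divr_gt0//.
by rewrite /a /b /c /d; nra.
Qed.

(** Induction on [n], shrinking [K] to the part where the last function is positive. If a member of
    [P] were nowhere positive there, [affine_alternative] would give a convex combination of the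
    two, again in [P], that is nowhere positive on [K]. *)
Lemma helly (E : lmodType R) (K : set E) (P : set (E -> R)) :
  cvx K -> cvx P -> K !=set0 -> (forall A, P A -> affine_on K A) ->
  (forall A, P A -> exists2 x, K x & 0 < A x) ->
  forall (A : nat -> E -> R) n, (forall i, (i < n)%N -> P (A i)) ->
  exists2 x, K x & forall i, (i < n)%N -> 0 < A i x.
Proof.
move=> + cP + + + A n; elim: n K => [|n IH] K cK K0 aff pos PA.
  by have [x Kx] := K0; exists x.
pose K' := [set x | K x /\ 0 < A n x].
have PAn := PA n (ltnSn n).
have [x0 Kx0 Ax0] := pos _ PAn.
have [|||||x [Kx Anx] Ax] := IH K'.
- move=> x y t [Kx Ax] [Ky Ay] t01; split; first exact: cK.
  rewrite aff//; nra.
- by exists x0.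
- by move=> B PB x y t [Kx _] [Ky _]; exact: aff.
- move=> B PB; apply: contrapT => nB.
  have [|t t01 tB] := affine_alternative cK (aff _ PAn) (aff _ PB).
    move=> x Kx Anx; rewrite leNgt; apply/negP => Bx.
    by apply: nB; exists x.
  have [x Kx] := pos _ (cP _ _ _ PB PAn t01).
  by rewrite ltNge => /negP; apply; exact: tB.
- by move=> i ltin; apply: PA; rewrite ltnS ltnW.
exists x => // i; rewrite ltnS leq_eqVlt => /predU1P[->//|]; exact: Ax.
Qed.

End helly.

Section hahn_banach.
Variables (R : realType) (V : lmodType R).

Definition sublinear (p : V -> R) :=
  (forall x y, p (x + y) <= p x + p y) /\
  (forall t x, 0 < t -> p (t *: x) = t * p x).

Lemma sublinear0 p : sublinear p -> p 0 = 0.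
Proof.
by move=> [_ pZ]; have := pZ 2 0 (ltr0Sn _ _); rewrite scaler0; lra.
Qed.

(* A sublinear minorant of [p]; if [p] is minimal it equals [p], which makes [p]
   additive. *)
Definition slope (p : V -> R) (x y : V) : R :=
  inf [set p (y + t *: x) - t * p x | t in [set t | 0 <= t]].

Lemma slope_lbound p x y : sublinear p ->
  lbound [set p (y + t *: x) - t * p x | t in [set t | 0 <= t]] (- p (- y)).
Proof.
move=> sp _ [t /= t0 <-]; have [pD pZ] := sp.
have tx : p (t *: x) = t * p x.
  have [->|tn0] := eqVneq t 0; first by rewrite scale0r mul0r sublinear0.
  by rewrite pZ// lt_def tn0.
by have := pD (y + t *: x) (- y); rewrite addrAC subrr add0r tx; lra.
Qed.

Lemma slope_le p x y t : sublinear p -> 0 <= t ->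
  slope p x y <= p (y + t *: x) - t * p x.
Proof.
move=> sp t0; apply: ge_inf; last by exists t.
by exists (- p (- y)); exact: slope_lbound.
Qed.

Lemma slope_lep p x y : sublinear p -> slope p x y <= p y.
Proof.
by move=> sp; have := slope_le x y sp (lexx 0); rewrite scale0r addr0 mul0r subr0.
Qed.

Lemma le_slope p x y m : sublinear p ->
  (forall t, 0 <= t -> m <= p (y + t *: x) - t * p x) -> m <= slope p x y.
Proof.
move=> sp h; apply: lb_le_inf; last by move=> _ [t /= t0 <-]; exact: h.
by exists (p (y + 0 *: x) - 0 * p x), 0 => //=.
Qed.

Lemma slope_sublinear p x : sublinear p -> sublinear (slope p x).
Proof.
move=> sp; have [pD pZ] := sp.
have hD y z : slope p x (y + z) <= slope p x y + slope p x z.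
  rewrite -lerBlDr; apply: le_slope => // s s0.
  rewrite lerBlDl -lerBlDr; apply: le_slope => // t t0.
  have := slope_le x (y + z) sp (addr_ge0 s0 t0).
  have := pD (y + s *: x) (z + t *: x).
  rewrite addrACA -scalerDl; lra.
have hZ t y : 0 < t -> slope p x (t *: y) <= t * slope p x y.
  move=> t0; rewrite mulrC -ler_pdivrMr//; apply: le_slope => // s s0.
  rewrite ler_pdivrMr// mulrC.
  have ts0 : 0 <= t * s by rewrite mulr_ge0// ltW.
  have := slope_le x (t *: y) sp ts0.
  by rewrite -scalerA -scalerDr pZ// mulrBr mulrA.
split=> // t y t0; apply/le_anti; rewrite hZ//=.
have /(hZ _ (t *: y)) : 0 < t^-1 by rewrite invr_gt0.
by rewrite scalerA mulVf ?gt_eqF// scale1r mulrC ler_pdivlMr// mulrC.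
Qed.

(** Zorn's lemma for the reversed pointwise order: a nonempty chain is bounded by its pointwise
    infimum, which is finite because [q <= p] forces [- p (- x) <= q x]. *)
Lemma minimal_sublinear p : sublinear p -> exists f, [/\ sublinear f,
  forall x, f x <= p x &
  forall q, sublinear q -> (forall x, q x <= f x) -> q = f].
Proof.
move=> sp.
pose T := {q : V -> R | sublinear q /\ forall x, q x <= p x}.
pose Rr : rel T := fun q r => `[< forall x, sval r x <= sval q x >].
have [|||A totA|[f [sf fp]] fmin] := @Zorn T Rr.
- by move=> q; apply/asboolP.
- move=> q r s /asboolP qr /asboolP rs; apply/asboolP => x.
  exact: le_trans (rs x) (qr x).
- move=> [q Hq] [r Hr] /asboolP /= qr /asboolP /= rq.
  apply: eq_exist => /=; apply/funext => x; apply/le_anti.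
  by rewrite qr rq.
- have [[a0 Aa0]|A0] := pselect (A !=set0); last first.
    exists (exist _ p (conj sp (fun x => lexx (p x)))) => s As.
    by exfalso; apply: A0; exists s.
  pose m x := inf [set sval q x | q in A].
  have lbA x : lbound [set sval q x | q in A] (- p (- x)).
    move=> _ [[q [sq qp]] _ <-] /=.
    have := qp (- x); have := sq.1 x (- x).
    rewrite subrr sublinear0//; lra.
  have mle x q : A q -> m x <= sval q x.
    move=> Aq; apply: ge_inf; last by exists q.
    by exists (- p (- x)).
  have lem x c : (forall q, A q -> c <= sval q x) -> c <= m x.
    move=> h; apply: lb_le_inf; first by exists (sval a0 x), a0.
    by move=> _ [q Aq <-]; exact: h.
  have sm : sublinear m.
    have mZ t x : 0 < t -> m (t *: x) <= t * m x.
      move=> t0; rewrite mulrC -ler_pdivrMr//; apply: (lem x) => q Aq.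
      rewrite ler_pdivrMr// mulrC; apply: le_trans (mle _ _ Aq) _.
      by have [[_ qZ] _] := svalP q; rewrite qZ.
    split=> [x y|t x t0].
      rewrite -lerBlDr; apply: (lem x) => q Aq.
      rewrite lerBlDl -lerBlDr; apply: (lem y) => r Ar.
      have [qr|rq] := totA q r Aq Ar.
        move/asboolP : qr => /(_ x) qr; have := mle (x + y) r Ar.
        by have [[/(_ x y) + _] _] := svalP r; lra.
      move/asboolP : rq => /(_ y) rq; have := mle (x + y) q Aq.
      by have [[/(_ x y) + _] _] := svalP q; lra.
    apply/le_anti; rewrite mZ//=.
    have /(mZ _ (t *: x)) : 0 < t^-1 by rewrite invr_gt0.
    by rewrite scalerA mulVf ?gt_eqF// scale1r mulrC ler_pdivlMr// mulrC.
  have mp x : m x <= p x.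
    by apply: le_trans (mle _ _ Aa0) _; have [_] := svalP a0.
  by exists (exist _ m (conj sm mp)) => q Aq; apply/asboolP => x; exact: mle.
- exists f; split=> // q sq qf.
  have qp x : q x <= p x := le_trans (qf x) (fp x).
  have := fmin (exist _ q (conj sq qp)).
  by move=> /(_ (asboolT qf)) /(congr1 sval).
Qed.

(** Minimality forces [slope f x = f], and the bound of [slope_le] at the parameter 1 is then
    superadditivity. *)
Lemma minimal_sublinear_linear f : sublinear f ->
  (forall q, sublinear q -> (forall x, q x <= f x) -> q = f) -> scalar f.
Proof.
move=> sf fmin; have [fD fZ] := sf.
have fA x y : f (x + y) = f x + f y.
  apply/le_anti; rewrite fD/=.
  have := slope_le x y sf ler01.
  rewrite (fmin _ (slope_sublinear x sf) (fun z => slope_lep x z sf)).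
  by rewrite scale1r mul1r [y + x]addrC; lra.
have fN x : f (- x) = - f x.
  by have := fA x (- x); rewrite subrr sublinear0//; lra.
move=> t x y; rewrite fA; congr (_ + _).
have [t0|t0|->] := ltgtP t 0.
- have := fZ (- t) x; rewrite oppr_gt0 scaleNr fN => /(_ t0); lra.
- exact: fZ.
- by rewrite scale0r mul0r sublinear0.
Qed.

(** The minimal minorant is taken below [slope p x] rather than below [p]: the slope at [- x] is at
    most [- p x], which forces [p x <= f x]. *)
Lemma hahn_banach p x : sublinear p ->
  exists f, [/\ scalar f, forall y, f y <= p y & f x = p x].
Proof.
move=> sp; have [f [sf fle fmin]] := minimal_sublinear (slope_sublinear x sp).
have lf := minimal_sublinear_linear sf fmin.
exists f; split => // [y|]; first exact: le_trans (fle y) (slope_lep x y sp).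
apply/le_anti; rewrite (le_trans (fle x) (slope_lep x x sp))/=.
have := le_trans (fle (- x)) (slope_le x (- x) sp ler01).
rewrite scale1r addNr mul1r sublinear0//.
have := lf (-1) x 0; rewrite scaleN1r !addr0 sublinear0// addr0; lra.
Qed.

End hahn_banach.

(** * James' theorem for a real seminorm *)

Section seminormed.
Variables (R : realType) (V : lmodType R).
Implicit Types (f g h : V -> R) (x y z : V).

Lemma scalarf0 f : scalar f -> f 0 = 0.
Proof. by move=> sf; have := sf 1 0 0; rewrite scaler0 addr0 mul1r; lra. Qed.

Lemma scalarfZ f t x : scalar f -> f (t *: x) = t * f x.
Proof. by move=> sf; have := sf t x 0; rewrite !addr0 scalarf0// addr0. Qed.

Lemma scalarfN f x : scalar f -> f (- x) = - f x.
Proof. by move=> sf; rewrite -scaleN1r scalarfZ// mulN1r. Qed.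

Lemma scalarfB f x y : scalar f -> f (x - y) = f x - f y.
Proof. by move=> sf; have := sf (-1) y x; rewrite scaleN1r [- y + x]addrC; lra. Qed.

Lemma scalar_lin f g t : scalar f -> scalar g -> scalar (t *: f + g).
Proof.
move=> sf sg a x y; rewrite !fctE sf sg /GRing.scale/=; ring.
Qed.

Definition seminorm (N : V -> R) :=
  (forall x y, N (x + y) <= N x + N y) /\ (forall t x, N (t *: x) = `|t| * N x).

Variable N : V -> R.
Hypothesis N_seminorm : seminorm N.

Lemma seminorm_sublinear : sublinear N.
Proof.
by have [ND NZ] := N_seminorm; split => // t x t0; rewrite NZ gtr0_norm.
Qed.

Lemma seminormN x : N (- x) = N x.
Proof. by rewrite -scaleN1r N_seminorm.2 normrN1 mul1r. Qed.

Lemma seminorm_ge0 x : 0 <= N x.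
Proof.
have := N_seminorm.1 x (- x); rewrite subrr seminormN.
by rewrite (sublinear0 seminorm_sublinear); lra.
Qed.

Definition bdual : set (V -> R) :=
  [set f | scalar f /\ exists C, forall x, f x <= C * N x].

Definition dual_ball : set (V -> R) :=
  [set f | scalar f /\ forall x, f x <= N x].

Lemma dual_ball_norm f x : dual_ball f -> `|f x| <= N x.
Proof.
move=> [sf fN]; rewrite ler_norml fN andbT.
by have := fN (- x); rewrite scalarfN// seminormN; lra.
Qed.

Lemma cvx_dual_ball : cvx dual_ball.
Proof.
move=> f g t [sf fN] [sg gN] t01; split.
  move=> a x y; rewrite !fctE sf sg /GRing.scale/=; ring.
move=> x; rewrite !fctE /GRing.scale/=; have := fN x; have := gN x; nra.
Qed.

Lemma dual_ball0 : dual_ball 0.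
Proof.
split; first by move=> a x y; rewrite /GRing.zero/= /cst/=; lra.
by move=> x; exact: seminorm_ge0.
Qed.

Lemma dual_ball_bdual f : dual_ball f -> bdual f.
Proof. by move=> [sf fN]; split=> //; exists 1 => x; rewrite mul1r. Qed.

Lemma bdual_lin f g t : bdual f -> bdual g -> bdual (t *: f + g).
Proof.
move=> [sf [C fC]] [sg [D gD]]; split; first exact: scalar_lin.
exists (`|t| * C + D) => x; rewrite !fctE /GRing.scale/= mulrDl lerD//.
rewrite -mulrA; have := fC x; have := fC (- x).
rewrite scalarfN// seminormN => H1 H2.
apply: le_trans (ler_norm _) _; rewrite normrM ler_wpM2l// ler_norml; lra.
Qed.

Lemma bdual_ball f : bdual f -> exists2 C, 0 < C & dual_ball (C^-1 *: f).
Proof.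
move=> [sf [C fC]]; exists (`|C| + 1); first by rewrite ltr_wpDl.
split; first by move=> a x y; rewrite !fctE sf /GRing.scale/=; ring.
move=> x; rewrite fctE /GRing.scale/= mulrC ler_pdivrMr ?ltr_wpDl//.
have := fC x; have := ler_norm C; have := seminorm_ge0 x; nra.
Qed.

End seminormed.

(** * Dependent choice along the natural numbers *)

Lemma exists_iter (T : Type) (P : nat -> T -> Prop) (Q : nat -> T -> T -> Prop)
    (t0 : T) : P 0%N t0 ->
  (forall n t, P n t -> exists t', P n.+1 t' /\ Q n t t') ->
  exists u : nat -> T, forall n, P n (u n) /\ Q n (u n) (u n.+1).
Proof.
move=> P0 PS.
have [F FP] : {F : nat * T -> T & forall p, P p.1 p.2 ->
    P p.1.+1 (F p) /\ Q p.1 p.2 (F p)}.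
  apply: (@choice _ _ (fun p t => P p.1 p.2 -> P p.1.+1 t /\ Q p.1 p.2 t)).
  move=> [n t]; have [/PS[t' Pt']|nP] := pselect (P n t); first by exists t'.
  by exists t.
pose u := nat_rect (fun=> T) t0 (fun n t => F (n, t)).
have Pu n : P n (u n) by elim: n => //= n /(FP (n, _))[].
by exists u => n; split=> //; have [] := FP (n, u n) (Pu n).
Qed.

(** For constructions whose next term depends on all earlier ones: each list extends the previous
    one by [rcons], and the last entries form the sequence. *)
Lemma exists_seq (T : Type) (Q : seq T -> Prop) : Q [::] ->
  (forall s, Q s -> exists x, Q (rcons s x)) ->
  exists u : nat -> T, forall n, Q (mkseq u n).
Proof.
move=> Q0 QS.
have [|n s [Qs <-]|S SP] := @exists_iter (seq T) (fun n s => Q s /\ size s = n)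
  (fun=> fun s t => exists x, t = rcons s x) [::]; first by [].
  have [x Qx] := QS s Qs; exists (rcons s x).
  by split; [rewrite size_rcons|exists x].
have [_ [x0 _]] := SP 0%N.
exists (fun n => nth x0 (S n.+1) n) => n.
suff -> : mkseq (fun n => nth x0 (S n.+1) n) n = S n by have [[]] := SP n.
elim: n => [|n IH]; first by have [[_ /size0nil->]] := SP 0%N.
have [[_ szn] [x Sx]] := SP n.
by rewrite mkseqS IH /= Sx nth_rcons szn ltnn eqxx.
Qed.

(** * A functional that does not attain its supremum on the ball *)

Section nonattaining.
Variables (R : realType) (V : lmodType R) (N : V -> R).
Hypothesis N_seminorm : seminorm N.
Variables (eta : R) (a : nat -> R) (g u : nat -> V -> R) (x : nat -> V).
(* [k] is the ratio of the weights, the tolerance and the slack at once; what is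
   needed is [4 * k < eta] and [k <= 1 / 4]. *)
Let k := eta / 8.
Let e n := k * (k / 2) ^+ n.+1.
Hypothesis eta_gt0 : 0 < eta.
Hypothesis a_ge : forall n, eta <= a n.
Hypothesis a_le2 : forall n, a n <= 2.
Hypothesis a_mono : forall n, a n <= a n.+1.
Hypothesis g_ball : forall n, dual_ball N (g n).
Hypothesis u0 : u 0%N = 0.
Hypothesis uS : forall n, u n.+1 = u n + (k ^+ n * (1 - k)) *: g n.
Hypothesis x_ball : forall n, N (x n) <= 1.
Hypothesis upper : forall n y, N y <= 1 -> exists m0, forall m, (m0 <= m)%N ->
  (u n + k ^+ n *: g n) y - g m y <= a n + e n.
Hypothesis lower : forall n m, (n < m)%N ->
  a n - e n <= (u n + k ^+ n *: g n) (x n) - g m (x n).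

Let k_gt0 : 0 < k. Proof. by rewrite divr_gt0. Qed.
Let k_le4 : k <= 4^-1.
Proof. by rewrite /k; have := a_ge 0%N; have := a_le2 0%N; lra. Qed.
Let kX_gt0 n : 0 < k ^+ n. Proof. exact: exprn_gt0. Qed.

(** The weights [k ^+ i * (1 - k)] telescope to [k ^+ n - k ^+ m], and every [g i] is in the dual
    ball. *)
Lemma nonattaining_tail n m y : (n <= m)%N ->
  `|u m y - u n y| <= (k ^+ n - k ^+ m) * N y.
Proof.
move=> /subnK <-; elim: (m - n)%N => [|d IH]; first
  by rewrite add0n !subrr normr0 mul0r.
rewrite addSn uS !fctE /GRing.scale/= exprS.
have := dual_ball_norm N_seminorm y (g_ball (d + n)).
have kd : 0 <= k ^+ (d + n) * (1 - k).
  by rewrite mulr_ge0 ?ltW//; have := k_le4; lra.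
move=> gN; rewrite addrAC; apply: le_trans (ler_normD _ _) _.
rewrite normrM (ger0_norm kd).
have := ler_wpM2l kd gN; lra.
Qed.

(** The functional is [v - w]. By [lower], its value at a maximizer [y] would be at least [A], the
    supremum of the [a n]; [upper], together with one index at which [g n y] hardly exceeds [w y],
    makes it smaller than [A]. *)
Lemma nonattaining : exists2 h, bdual N h &
  forall y, N y <= 1 -> exists2 z, N z <= 1 & h y < h z.
Proof.
have [U [UU ooU]] := @ultraFilterLemma nat (\oo : set_system nat) _.
have UP : ProperFilter U := ultra_proper.
have Uge m : U [set n | (m <= n)%N] by apply: ooU; exists m.
(* A bounded real sequence has a cluster point along [U] by compactness, and for an ultrafilter a
   cluster point is a limit. *)
have cvgU (s : nat -> R) M : (forall n, `|s n| <= M) -> cvg (s n @[n --> U]).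
  move=> sM; have [|l [_ sl]] := @segment_compact R (- M) M (s @ U) _.
    suff : U (s @^-1` `[- M, M]) by [].
    by apply: filterE => n; rewrite /= in_itv /= -ler_norml.
  apply/cvg_ex; exists l => B Bl.
  have [//|nB] := in_ultra_setVsetC (s @^-1` B) UU.
  by have [z [nBz /nBz]] := sl (~` B) B nB Bl.
have gle n y : `|g n y| <= N y by exact: dual_ball_norm.
have u0y y : u 0%N y = 0 by rewrite u0.
have ule n y : `|u n y| <= N y.
  have := nonattaining_tail y (leq0n n); rewrite u0y subr0 expr0.
  have := seminorm_ge0 N_seminorm y; have := kX_gt0 n; nra.
have gc y := cvgU (fun n => g n y) _ (gle ^~ y).
have uc y := cvgU (fun n => u n y) _ (ule ^~ y).
have limS (s : nat -> V -> R) : (forall n, scalar (s n)) ->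
    (forall y, cvg (s n y @[n --> U])) ->
    scalar (fun y => lim (s n y @[n --> U])).
  move=> ss sc t y z; apply/cvg_lim => //.
  rewrite (_ : (fun n => s n (t *: y + z)) = (fun n => t * s n y + s n z)).
    by apply: cvgD; [apply: cvgM; [exact: cvg_cst|exact: sc]|exact: sc].
  by apply/funext => n; rewrite ss.
have us n : scalar (u n).
  elim: n => [|n IH]; first by rewrite u0; have [] := dual_ball0 N_seminorm.
  by rewrite uS addrC; apply: scalar_lin => //; have [] := g_ball n.
pose w y : R := lim (g n y @[n --> U]); pose v y : R := lim (u n y @[n --> U]).
have ws : scalar w by apply: limS => // n; have [] := g_ball n.
have vs : scalar v by exact: limS.
have wN y : `|w y| <= N y.
  have gy n := gle n y; rewrite ler_norml; apply/andP; split.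
    apply: limr_ge; first exact: gc.
    by apply: filterE => n; have := gy n; rewrite ler_norml => /andP[].
  apply: limr_le; first exact: gc.
  by apply: filterE => n; have := gy n; rewrite ler_norml => /andP[].
have vu n y : `|v y - u n y| <= k ^+ n * N y.
  have uy m : (n <= m)%N -> `|u m y - u n y| <= k ^+ n * N y.
    move=> nm; apply: le_trans (nonattaining_tail y nm) _.
    by rewrite ler_wpM2r ?seminorm_ge0// lerBlDr lerDl ltW.
  rewrite ler_distl; apply/andP; split.
    apply: limr_ge; first exact: uc.
    apply: filterS (Uge n) => m /uy; rewrite ler_norml => /andP[]; lra.
  apply: limr_le; first exact: uc.
  apply: filterS (Uge n) => m /uy; rewrite ler_norml => /andP[]; lra.
have v_le y : `|v y| <= N y.
  by have := vu 0%N y; rewrite u0y expr0 mul1r subr0.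
exists (fun y => v y - w y).
  split; first by move=> t y z; rewrite vs ws; ring.
  exists 2 => y; have := v_le y; have := wN y.
  by rewrite !ler_norml => /andP[] + _ /andP[_]; lra.
move=> y yB; apply: contrapT => ny.
have ymax z : N z <= 1 -> v z - w z <= v y - w y.
  by move=> zB; rewrite leNgt; apply/negP => lt; apply: ny; exists z.
have e_le n : e n <= k ^+ n.
  rewrite /e -[leRHS]mul1r; apply: ler_pM => //.
  - exact: ltW.
  - by rewrite exprn_ge0// divr_ge0// ltW.
  - by have := k_le4; lra.
  - rewrite exprS -[leRHS]mul1r; have := k_gt0; have := k_le4 => k4 k0.
    apply: ler_pM; [lra|apply: exprn_ge0; lra|lra|].
    by apply: lerXn2r; rewrite ?nnegrE; lra.
(* Take the limit in [lower] at [x n]. Replacing [u n + k ^+ n *: g n] by [v] costs [k ^+ n] for the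
   tail and [k ^+ n] for the last term; the tolerance [e n] is the third [k ^+ n]. *)
have a_near n : a n <= v y - w y + 3 * k ^+ n.
  have := ymax _ (x_ball n); have := e_le n.
  have : w (x n) <= (u n + k ^+ n *: g n) (x n) - (a n - e n).
    apply: limr_le; first exact: gc.
    by apply: filterS (Uge n.+1) => m /lower; lra.
  rewrite !fctE /GRing.scale/=.
  have := vu n (x n); have := gle n (x n); have := x_ball n.
  have := kX_gt0 n; move: (k ^+ n) => q q0 xB.
  rewrite !ler_norml => /andP[g1 g2] /andP[v1 v2].
  by have := ler_wpM2l (ltW q0) xB; have := ler_wpM2l (ltW q0) g2; lra.
have a_homo n m : (n <= m)%N -> a n <= a m.
  by move=> /subnK <-; elim: (m - n)%N => // d /le_trans; apply; rewrite addSn.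
(* As [a] is nondecreasing, the error of [a_near] may be taken at an arbitrarily large index. *)
have a_leh n : a n <= v y - w y.
  rewrite leNgt; apply/negP => lt.
  have k1 : `|k| < 1 by rewrite gtr0_norm//; have := k_le4; lra.
  have /cvgrPdist_lt := cvg_expr k1.
  move=> /(_ ((a n - (v y - w y)) / 3) _)[|m0 _ /(_ (maxn m0 n))].
    by rewrite divr_gt0// subr_gt0.
  rewrite /= leq_maxl => /(_ isT); rewrite sub0r normrN (gtr0_norm (kX_gt0 _)).
  have := a_homo n _ (leq_maxr m0 n); have := a_near (maxn m0 n).
  by move: (k ^+ maxn m0 n) => q; lra.
have ha : has_sup (range a).
  by split; [exists (a 0%N), 0%N|exists 2 => _ [n _ <-]].
set A := sup (range a).
have A_le : A <= v y - w y by apply: ge_sup => [|_ [n _ <-]//]; case: ha.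
have leA n : a n <= A by apply: sup_upper_bound => //; exists n.
(* Writing [v_n = u_n + k^n g_n], the partial sums satisfy
   [u_(n+1) - (1 - k^(n+1)) w = k (u_n - (1 - k^n) w) + (1 - k) (v_n - w)]. *)
have partial n : u n y - (1 - k ^+ n) * w y <=
    A * (1 - k ^+ n) + k * k ^+ n * (1 - 2^-1 ^+ n).
  elim: n => [|n IH].
    by rewrite u0y !expr0 !subrr mul0r !mulr0 subr0 addr0.
  have : (u n + k ^+ n *: g n) y - (a n + e n) <= w y.
    have [m0 um] := upper n yB; apply: limr_ge; first exact: gc.
    by apply: filterS (Uge m0) => m /um; lra.
  have : e n = k * k ^+ n.+1 * 2^-1 ^+ n.+1 by rewrite /e exprMn mulrA.
  rewrite uS !fctE /GRing.scale/= !exprS => -> up.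
  have := leA n; have := k_le4; have := k_gt0; have := kX_gt0 n.
  have : 0 <= 2^-1 ^+ n :> R by rewrite exprn_ge0// invr_ge0.
  move: up IH; move: (k ^+ n) (2^-1 ^+ n) (w y) (u n y) (g n y) (a n) (v y).
  move=> q p W un gn an _ up IH p0 q0 k0 k4 anA.
  have k1 : 0 <= 1 - k by lra.
  have H1 := ler_wpM2l (ltW k0) IH.
  have H2 : (1 - k) * (un + q * gn - W) <=
      (1 - k) * (A + k * (k * q) * (2^-1 * p)).
    by apply: ler_wpM2l => //; lra.
  have H3 : 0 <= k * (k * (k * q) * (2^-1 * p)).
    by rewrite !mulr_ge0// ltW.
  lra.
(* Such an index exists because [w y] is the limit of the [g n y]. Adding this term to [partial] and
   bounding the tail by [k ^+ n.+1] gives [v y - w y <= A - A * k ^+ n + 4 * k ^+ n.+1], while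
   [8 * k <= A]; this contradicts [A_le]. *)
have [n gn] : exists n, g n y <= w y + k.
  have /cvgrPdist_lt/(_ _ k_gt0) /filter_ex[n] := gc y.
  by rewrite ltr_norml => /andP[? _]; exists n; rewrite /w; lra.
have := partial n; have := vu n.+1 y; rewrite uS !fctE /GRing.scale/= exprS.
have := wN y; have := gle n y; have := leA 0%N; have := a_ge 0%N.
have : 0 <= 2^-1 ^+ n :> R by rewrite exprn_ge0// invr_ge0.
have := k_gt0; have := k_le4; have : eta = 8 * k by rewrite /k; lra.
have := kX_gt0 n; move: gn A_le yB; move: (N y) (2^-1 ^+ n).
move: (k ^+ n) (w y) (u n y) (g n y) (a 0%N) (v y) => q W un gn a0' vy Ny p.
move=> gW Avy N1 q0 etaE k4 k0 p0 ea aA.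
rewrite !ler_norml => /andP[g1 g2] /andP[w1 w2] /andP[v1 v2] part.
have k1 : 0 <= 1 - k by lra.
have H1 := ler_wpM2l (mulr_ge0 (ltW q0) k1) gW.
have kq0 : 0 < k * q by rewrite mulr_gt0.
have H2 := ler_wpM2l (ltW kq0) N1.
have H3 : k * q * - W <= k * q * 1 by apply: ler_wpM2l; [exact: ltW|lra].
have H4 : 0 <= k * q * p by rewrite mulr_ge0// ltW.
have H5 : q * (8 * k) <= q * A by apply: ler_wpM2l; [exact: ltW|lra].
have H6 : 0 <= k * (k * q) by rewrite mulr_ge0// ltW.
lra.
Qed.
End nonattaining.

(** * James' inductive choice of functionals *)

Section james_sequence.
Variables (R : realType) (V : lmodType R) (N : V -> R).
Hypothesis N_seminorm : seminorm N.
Variables (x : nat -> V) (th de : R).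
Hypothesis de_th : de < th.
Hypothesis x_ball : forall n, N (x n) <= 1.

Definition james_tail n : set (V -> R) := [set g | [/\ dual_ball N g,
  exists m, forall i, (m <= i)%N -> th <= g (x i) &
  forall i, (i < n)%N -> g (x i) <= de]].
Local Notation T := james_tail.
Hypothesis T_neq0 : forall n, T n !=set0.

Let eta := th - de.
Let k := eta / 8.
Let eta_gt0 : 0 < eta. Proof. by rewrite subr_gt0. Qed.
Let k_gt0 : 0 < k. Proof. by rewrite divr_gt0. Qed.

Definition meets_tails (C : set (V -> R)) :=
  cvx C /\ forall n, exists2 g, C g & T n g.

(* [sup_y (u y - liminf_g (g y)) <= r] up to the boundary case, the lower limit
   being taken over [C] along the tails. *)
Definition gap_le (u : V -> R) (C : set (V -> R)) (r : R) :=
  forall y, N y <= 1 -> exists n, forall g, C g -> T n g -> u y - g y <= r.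

Lemma james_tail_sub m n : (m <= n)%N -> T n `<=` T m.
Proof.
move=> mn g [gB gth gde]; split=> // i im; apply: gde; exact: leq_trans mn.
Qed.

Lemma cvx_james_tail n : cvx (T n).
Proof.
move=> f g t [fB [mf fth] fde] [gB [mg gth] gde] t01; split.
- exact: cvx_dual_ball.
- exists (maxn mf mg) => i; rewrite geq_max => /andP[/fth H1 /gth H2].
  by rewrite !fctE /GRing.scale/=; nra.
- move=> i lt; rewrite !fctE /GRing.scale/=.
  by have := fde i lt; have := gde i lt; nra.
Qed.

Lemma meets_tails0 : meets_tails (T 0).
Proof.
split; first exact: cvx_james_tail.
move=> n; have [g Tg] := T_neq0 n; exists g => //.
exact: (james_tail_sub (leq0n n)).
Qed.

(** Test at a point [x m] where [g] has reached [th]: members of [T m.+1] are at most [de] there. *)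
Lemma gap_le_ge g C r : T 0 g -> meets_tails C -> gap_le g C r -> eta <= r.
Proof.
move=> [_ [m gth] _] [_ Cm] up; have [n /= un] := up _ (x_ball m).
have [f Cf Tf] := Cm (maxn n m.+1).
have := un f Cf (james_tail_sub (leq_maxl _ _) Tf).
have [_ _ /(_ m)] := Tf; rewrite leq_max ltnSn orbT => /(_ isT).
by have := gth m (leqnn m); rewrite /eta; lra.
Qed.

Lemma gap_le2 g C : T 0 g -> gap_le g C 2.
Proof.
move=> [gB _ _] y yB; exists 0%N => f _ [fB _ _].
have := dual_ball_norm N_seminorm y gB; have := dual_ball_norm N_seminorm y fB.
by rewrite !ler_norml => /andP[? ?] /andP[? ?]; lra.
Qed.

Let k_le4 : k <= 4^-1.
Proof.
have [g Tg] := T_neq0 0.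
by have := gap_le_ge Tg meets_tails0 (gap_le2 _ Tg); rewrite /k; lra.
Qed.

(** A failure of [gap_le] happens at a single point [y]; the members of [C] witnessing it occur in
    every tail and form a convex set. Shrinking [C] to them makes all later choices respect the
    lower bound at [y]. *)
Lemma gap_gt u C r : meets_tails C -> ~ gap_le u C r ->
  exists2 y, N y <= 1 & meets_tails [set g | C g /\ r < u y - g y].
Proof.
move=> [cC Cm] nup; apply: contrapT => ny; apply: nup => y yB.
apply: contrapT => nn; apply: ny; exists y => //; split.
  move=> f g t [Cf fr] [Cg gr] t01; split; first exact: cC.
  by rewrite !fctE /GRing.scale/=; have [t2|t2] := ltP 2^-1 t; nra.
move=> n; apply: contrapT => ng; apply: nn; exists n => g Cg Tg.
by rewrite leNgt; apply/negP => lt; apply: ng; exists g.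
Qed.

(** The gaps within reach of the next choice; their infimum becomes the [a n] of [nonattaining]. *)
Definition gaps n (u : V -> R) (C : set (V -> R)) : set R :=
  [set r | exists g C', [/\ C g, T n g, C' `<=` C, meets_tails C' &
    gap_le (u + k ^+ n *: g) C' r]].

(** The second clause records that [u] behaves like a sum of elements of [T 0] of total weight
    [1 - k ^+ n], to be completed to a convex combination. *)
Definition james_state n (u : V -> R) (C : set (V -> R)) :=
  meets_tails C /\ forall g, T 0 g -> T 0 (u + k ^+ n *: g).

Lemma gaps_ge n u C r : james_state n u C -> gaps n u C r -> eta <= r.
Proof.
move=> [mC uT] [g [C' [Cg Tg C'C mC' up]]]; apply: gap_le_ge mC' up.
by apply: uT; exact: james_tail_sub Tg.
Qed.

Lemma gaps2 n u C : james_state n u C -> gaps n u C 2.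
Proof.
move=> [mC uT]; have [g Cg Tg] := mC.2 n; exists g, C; split=> //.
by apply: gap_le2; apply: uT; exact: james_tail_sub Tg.
Qed.

Lemma has_inf_gaps n u C : james_state n u C -> has_inf (gaps n u C).
Proof.
by move=> s; split; [exists 2; exact: gaps2|exists eta => r; exact: gaps_ge].
Qed.

(** Choose [g] and [C'] with gap below the infimum plus [e]. The infimum minus [e] is not a gap for
    [C'], so [gap_gt] yields [y] and a further shrinking, which keeps the upper bound. *)
Lemma james_step n u C e : 0 < e -> james_state n u C ->
  exists g C' y, [/\ C g, T n g, C' `<=` C & meets_tails C'] /\
    [/\ N y <= 1, gap_le (u + k ^+ n *: g) C' (inf (gaps n u C) + e) &
    forall f, C' f -> inf (gaps n u C) - e < (u + k ^+ n *: g) y - f y].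
Proof.
move=> e0 s; have hi := has_inf_gaps s.
have [r [g [C' [Cg Tg C'C mC' up]]] re] := inf_adherent e0 hi.
have [|y yB my] := @gap_gt (u + k ^+ n *: g) C' (inf (gaps n u C) - e) mC'.
  move=> up'; have : gaps n u C (inf (gaps n u C) - e) by exists g, C'.
  by move=> /(ge_inf hi.2); lra.
exists g, [set f | C' f /\ inf (gaps n u C) - e < (u + k ^+ n *: g) y - f y], y.
split; split=> //.
- by move=> f [/C'C].
- move=> z zB; have [m um] := up z zB; exists m => f [C'f _] Tf.
  by apply: le_trans (um f C'f Tf) _; exact: ltW.
- by move=> f [].
Qed.

Lemma james_state_next n u C g C' : james_state n u C -> T 0 g ->
  meets_tails C' -> james_state n.+1 (u + (k ^+ n * (1 - k)) *: g) C'.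
Proof.
move=> [_ uT] Tg mC'; split=> // f Tf.
rewrite (_ : _ + _ = u + k ^+ n *: (k *: f + (1 - k) *: g)).
  apply: uT; apply: cvx_james_tail => //.
  by have := k_le4; have := k_gt0; lra.
by apply/funext => y; rewrite !fctE /GRing.scale/= exprS; ring.
Qed.

(** A choice [f] at stage [n.+1] amounts to the choice [k *: f + (1 - k) *: g] at stage [n], so the
    infimum cannot drop. *)
Lemma gaps_next n u C g C' : james_state n u C -> C g -> T n g -> C' `<=` C ->
  meets_tails C' ->
  inf (gaps n u C) <= inf (gaps n.+1 (u + (k ^+ n * (1 - k)) *: g) C').
Proof.
move=> s Cg Tg C'C mC'.
have s' := james_state_next s (james_tail_sub (leq0n n) Tg) mC'.
apply: lb_le_inf; first by have [] := has_inf_gaps s'.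
move=> r [f [D [C'f Tf DC' mD up]]]; apply: ge_inf.
  by have [] := has_inf_gaps s.
have k01 : 0 <= k <= 1 by have := k_le4; have := k_gt0; lra.
exists (k *: f + (1 - k) *: g), D; split=> //.
- by apply: s.1.1 => //; exact: C'C.
- by apply: cvx_james_tail => //; exact: james_tail_sub Tf.
- by move=> h /DC' /C'C.
- rewrite (_ : u + _ = u + (k ^+ n * (1 - k)) *: g + k ^+ n.+1 *: f)//.
  by apply/funext => y; rewrite !fctE /GRing.scale/= exprS; ring.
Qed.

Lemma james_functional : exists2 h, bdual N h &
  forall y, N y <= 1 -> exists2 z, N z <= 1 & h y < h z.
Proof.
pose e n := k * (k / 2) ^+ n.+1.
have e0 n : 0 < e n by rewrite mulr_gt0// exprn_gt0// divr_gt0.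
(* A state holds the current [u] and [C] and the [g] and [y] chosen in the step leading to it. Hence
   [g n] and [y n] are read from [s n.+1], and the initial pair [(0, 0)] is a placeholder. *)
pose St := (((V -> R) * set (V -> R)) * ((V -> R) * V))%type.
pose A n (s : St) := inf (gaps n s.1.1 s.1.2).
pose Q n (s t : St) := [/\ [/\ s.1.2 t.2.1, T n t.2.1, t.1.2 `<=` s.1.2 &
  t.1.1 = s.1.1 + (k ^+ n * (1 - k)) *: t.2.1],
  N t.2.2 <= 1, A n s <= A n.+1 t,
  gap_le (s.1.1 + k ^+ n *: t.2.1) t.1.2 (A n s + e n) &
  forall f, t.1.2 f -> A n s - e n < (s.1.1 + k ^+ n *: t.2.1) t.2.2 - f t.2.2].
have [||s sP] := @exists_iter St
  (fun n s => james_state n s.1.1 s.1.2 /\ (n = 0%N -> s.1.1 = 0)) Q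
  ((0, T 0), (0, 0)).
- split=> //; split; first exact: meets_tails0.
  by move=> g; rewrite expr0 scale1r add0r.
- move=> n [[u C] [g' y']] /= [su _].
  have [g [C' [y [[Cg Tg C'C mC'] [yB up low]]]]] := james_step (e0 n) su.
  exists ((u + (k ^+ n * (1 - k)) *: g, C'), (g, y)); split=> /=.
    split=> //; apply: (james_state_next su) => //.
    exact: (james_tail_sub (leq0n n) Tg).
  split=> //; exact: gaps_next.
pose u n := (s n).1.1; pose C n := (s n).1.2.
pose g n := (s n.+1).2.1; pose y n := (s n.+1).2.2.
have Csub m n : (m <= n)%N -> C n `<=` C m.
  move=> /subnK <-; elim: (n - m)%N => // d IH f Cf; apply: IH.
  by have [_ [[_ _ + _] _ _ _ _]] := sP (d + m)%N; apply.
apply: (@nonattaining _ _ _ N_seminorm eta (fun n => A n (s n)) g u y) => //.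
- move=> n; have [[sn _] _] := sP n.
  apply: lb_le_inf; first by have [] := has_inf_gaps sn.
  by move=> r; exact: gaps_ge.
- move=> n; have [[sn _] _] := sP n; apply: ge_inf; last exact: gaps2.
  by have [] := has_inf_gaps sn.
- by move=> n; have [_ []] := sP n.
- by move=> n; have [_ [[_ [] ]]] := sP n.
- by have [[_ /(_ erefl)]] := sP 0%N.
- by move=> n; have [_ [[_ _ _ us] _ _ _ _]] := sP n.
- by move=> n; have [_ []] := sP n.
- move=> n z zB; have [_ [_ _ _ /(_ z zB)[m0 um] _]] := sP n.
  (* From [n.+1] on, [g m] lies in the set left after step [n]; from [m0] on, it lies in the tail
     where the bound at [z] holds. *)
  exists (maxn n.+1 m0) => m; rewrite geq_max => /andP[nm m0m].
  have [_ [[Cg Tg _ _] _ _ _ _]] := sP m.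
  by apply: um; [exact: (Csub _ _ nm)|exact: (james_tail_sub m0m Tg)].
- move=> n m nm; have [_ [_ _ _ _ /(_ (g m))H]] := sP n; apply: ltW; apply: H.
  have [_ [[Cg Tg _ _] _ _ _ _]] := sP m; exact: (Csub _ _ nm).
Qed.

End james_sequence.

(** * Distance from the evaluations and James' theorem *)

Section james.
Variables (R : realType) (V : lmodType R) (N : V -> R).
Hypothesis N_seminorm : seminorm N.
Variables (F : (V -> R) -> R) (M : R).
Hypothesis F_lin : forall f g t, bdual N f -> bdual N g ->
  F (t *: f + g) = t * F f + F g.
Hypothesis M_gt0 : 0 < M.
Hypothesis F_le : forall f, dual_ball N f -> F f <= M.

Let bdual0 : bdual N 0.
Proof. exact/dual_ball_bdual/dual_ball0. Qed.

Let F0 : F 0 = 0.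
Proof. by have := F_lin 1 bdual0 bdual0; rewrite scale1r addr0; lra. Qed.

Let FZ t f : bdual N f -> F (t *: f) = t * F f.
Proof. by move=> fb; have := F_lin t fb bdual0; rewrite addr0 F0 addr0. Qed.

Let F_affine : affine_on (dual_ball N) F.
Proof.
move=> f g t /dual_ball_bdual fb /dual_ball_bdual gb _.
rewrite F_lin// ?FZ// -[_ *: g]addr0; exact: bdual_lin.
Qed.

Section far_from_evaluations.
Variable r : R.
Hypothesis r_gt0 : 0 < r.
Hypothesis F_far : forall y, exists2 f, dual_ball N f & r < F f - f y.

(** [helly] on the dual ball, for a convex family containing [F f - r] and all [d - f (x i)]. A
    member with [0 < l] is positive somewhere because [F] is far from the evaluation at [l^-1 *: y];
    one with [l = 0] is positive at [f = 0]. *)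
Lemma far_vanishing (d : R) (x : nat -> V) n : 0 < d ->
  exists2 f, dual_ball N f & r < F f /\ forall i, (i < n)%N -> f (x i) < d.
Proof.
move=> d0.
pose P := [set A : (V -> R) -> R | exists l y, 0 <= l <= 1 /\
  forall f, dual_ball N f -> A f = l * (F f - r) - f y + (1 - l) * d].
pose A i := if (i < n)%N then fun f : V -> R => d - f (x i)
            else fun f => F f - r.
have [|||||i _|f fb fA] := @helly R (V -> R) (dual_ball N) P _ _ _ _ _ A n.+1.
- exact: cvx_dual_ball.
- move=> A1 A2 t [l1 [y1 [l1b A1E]]] [l2 [y2 [l2b A2E]]] t01.
  exists (t * l1 + (1 - t) * l2), (t *: y1 + (1 - t) *: y2); split; first nra.
  move=> f fb; have [sf _] := fb.
  rewrite !fctE A1E// A2E// (sf t y1) (scalarfZ _ y2 sf) /GRing.scale/=; ring.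
- by exists 0; exact: dual_ball0.
- move=> B [l [y [l01 BE]]] f g t fb gb t01.
  rewrite !BE//; last exact: cvx_dual_ball.
  by rewrite F_affine// !fctE /GRing.scale/=; ring.
- move=> B [l [y [/andP[l0 l1] BE]]].
  move: l0; rewrite le_eqVlt => /predU1P[l0|l0].
    exists (0 : V -> R); first exact: dual_ball0.
    rewrite BE; last exact: dual_ball0.
    by rewrite -l0 mul0r sub0r subr0 mul1r oppr0 add0r.
  have [f fb fr] := F_far (l^-1 *: y); exists f => //.
  rewrite BE//; have [sf _] := fb; move: fr; rewrite scalarfZ// => fr.
  have : l * r < l * (F f - l^-1 * f y) by rewrite ltr_pM2l.
  rewrite [ltRHS]mulrBr mulrA mulfV ?gt_eqF// mul1r.
  have : 0 <= (1 - l) * d by rewrite mulr_ge0 ?subr_ge0// ltW.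
  lra.
- rewrite /A; case: ifP => _.
    by exists 0, (x i); rewrite lexx ler01; split=> // f _; ring.
  exists 1, 0; rewrite lexx ler01; split=> // f [sf _].
  by rewrite scalarf0//; ring.
exists f => //; split=> [|i ltin].
  by have := fA n (ltnSn n); rewrite /A ltnn; lra.
by have := fA i (ltnW ltin); rewrite /A ltin; lra.
Qed.

(** If [f] stayed below [r / M] on the ball, [(r / M)^-1 *: f] would be in the dual ball, and [F_le]
    would give [F f <= r]. *)
Lemma ball_gt f : dual_ball N f -> r < F f -> exists2 x, N x <= 1 & r / M < f x.
Proof.
move=> fb rF; apply: contrapT => nx; move: rF; apply/negP; rewrite -leNgt.
have rM : 0 < r / M by rewrite divr_gt0.
have [sf fN] := fb.
have fle x : f x <= r / M * N x.
  have := seminorm_ge0 N_seminorm x; rewrite le_eqVlt => /predU1P[Nx|Nx].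
    by have := fN x; rewrite -Nx mulr0.
  rewrite -ler_pdivrMr// mulrC -scalarfZ// leNgt; apply/negP => lt; apply: nx.
  exists ((N x)^-1 *: x) => //.
  by rewrite N_seminorm.2 gtr0_norm ?invr_gt0// mulVf// gt_eqF.
have : F ((r / M)^-1 *: f) <= M.
  apply: F_le; split.
    by move=> t x y; rewrite !fctE sf /GRing.scale/=; ring.
  by move=> x; rewrite fctE /GRing.scale/= mulrC ler_pdivrMr// mulrC.
rewrite FZ; last exact: dual_ball_bdual.
by rewrite mulrC ler_pdivrMr// [M * _]mulrC divfK// gt_eqF.
Qed.

(** [helly] on the unit ball of [V], for the functions [f - r / M] with [r < F f]: they form a
    convex family since [F] is affine, and [ball_gt] makes each positive somewhere. *)
Lemma far_helly (f : nat -> V -> R) n :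
  (forall i, (i < n)%N -> dual_ball N (f i) /\ r < F (f i)) ->
  exists2 x, N x <= 1 & forall i, (i < n)%N -> r / M < f i x.
Proof.
move=> fP.
pose P := [set A : V -> R | exists2 f, dual_ball N f /\ r < F f &
  forall x, A x = f x - r / M].
have [|||||i /fP[fb rF]|x xB fA] := @helly R V [set x | N x <= 1] P _ _ _ _ _
  (fun i x => f i x - r / M) n.
- move=> x y t /= xB yB t01; apply: le_trans (N_seminorm.1 _ _) _.
  rewrite !N_seminorm.2 !ger0_norm; [nra|lra|lra].
- move=> A1 A2 t [f1 [f1b f1r] A1E] [f2 [f2b f2r] A2E] t01.
  exists (t *: f1 + (1 - t) *: f2).
    split; first exact: cvx_dual_ball.
    rewrite F_affine//; have [t2|t2] := ltP 2^-1 t; nra.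
  by move=> x; rewrite !fctE /GRing.scale/= A1E A2E; ring.
- by exists 0; rewrite /= (sublinear0 (seminorm_sublinear N_seminorm)).
- move=> A [g [[sg _] _] AE] x y t _ _ _; rewrite !AE sg scalarfZ//; ring.
- move=> A [g [gb rF] AE]; have [x xB gx] := ball_gt gb rF.
  by exists x => //; rewrite AE subr_gt0.
- by exists (f i).
by exists x => // i ltin; have := fA i ltin; rewrite subr_gt0.
Qed.

(** Functionals and points are chosen in turn: the new functional is small at all earlier points,
    the new point makes all functionals so far exceed [r / M]. The [n]-th functional then lies in
    the [n]-th tail set. *)
Lemma far_nonattaining : exists2 h, bdual N h &
  forall y, N y <= 1 -> exists2 z, N z <= 1 & h y < h z.
Proof.
pose th := r / M; pose de := th / 2.
have th0 : 0 < th by rewrite divr_gt0.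
have de0 : 0 < de by rewrite divr_gt0.
pose d : V * (V -> R) := (0, 0).
pose Q (s : seq (V * (V -> R))) :=
  (forall i, (i < size s)%N -> [/\ dual_ball N (nth d s i).2,
     r < F (nth d s i).2 & N (nth d s i).1 <= 1]) /\
  forall i j, (i < size s)%N -> (j < size s)%N ->
    if (i <= j)%N then th < (nth d s i).2 (nth d s j).1
    else (nth d s i).2 (nth d s j).1 < de.
have [//|s [s1 s2]|u uQ] := @exists_seq _ Q.
  have [f fb [rF fd]] := far_vanishing (fun i => (nth d s i).1) (size s) de0.
  (* The point [0] paired with [f] is a placeholder; only the functionals of the list are read
     here. *)
  have [|x xB xf] :=
    @far_helly (fun i => (nth d (rcons s (0, f)) i).2) (size s).+1.
    move=> i; rewrite ltnS nth_rcons leq_eqVlt => /predU1P[->|lt].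
      by rewrite ltnn eqxx.
    by rewrite lt; have [] := s1 i lt.
  exists (x, f); split.
    move=> i; rewrite size_rcons ltnS nth_rcons leq_eqVlt => /predU1P[->|lt].
      by rewrite ltnn eqxx.
    by rewrite lt; exact: s1.
  move=> i j; rewrite size_rcons !ltnS !nth_rcons => is' js.
  have := xf i is'; rewrite nth_rcons => xi.
  move: js; rewrite leq_eqVlt => /predU1P[->|js].
    by rewrite is' ltnn eqxx; move: xi; case: ifP => //; case: ifP.
  move: is' xi; rewrite leq_eqVlt => /predU1P[->|is'].
    by move=> _; rewrite ltnn eqxx js leqNgt js; exact: fd.
  by rewrite js is' => _; exact: s2.
have uP i j : [/\ dual_ball N (u i).2, N (u j).1 <= 1 &
    if (i <= j)%N then th < (u i).2 (u j).1 else (u i).2 (u j).1 < de].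
  have iM : (i < (maxn i j).+1)%N by rewrite ltnS leq_maxl.
  have jM : (j < (maxn i j).+1)%N by rewrite ltnS leq_maxr.
  have [+ +] := uQ (maxn i j).+1; rewrite size_mkseq => H1 /(_ i j iM jM).
  have := H1 i iM; have := H1 j jM; rewrite !nth_mkseq//.
  by move=> [_ _ ?] [? _ _].
apply: (@james_functional _ _ _ N_seminorm (fun n => (u n).1) th de).
- by rewrite /de; lra.
- by move=> n; have [] := uP n n.
move=> n; exists (u n).2; split; first by have [] := uP n n.
  by exists n => i ni; have [_ _] := uP n i; rewrite ni => /ltW.
by move=> i lt; have [_ _] := uP n i; rewrite leqNgt lt /= => /ltW.
Qed.

End far_from_evaluations.

Hypothesis N_complete : forall y : nat -> V,
  (forall m n, N (y m - y n) <= m.+1%:R^-1 + n.+1%:R^-1) ->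
  exists z, forall n, N (y n - z) <= n.+1%:R^-1.

(** Attainment rules out a positive distance, so evaluations approximate [F] uniformly on the dual
    ball; their points are Cauchy for [N], and the limit represents [F]. *)
Theorem james :
  (forall f, bdual N f ->
    exists2 x, N x <= 1 & forall y, N y <= 1 -> f y <= f x) ->
  exists x, forall f, bdual N f -> F f = f x.
Proof.
move=> att.
have near r : 0 < r -> exists y, forall f, dual_ball N f -> F f - f y <= r.
  move=> r0; apply: contrapT => ny.
  have [|h hb hP] := far_nonattaining r0.
    move=> y; apply: contrapT => nf; apply: ny; exists y => f fb.
    by rewrite leNgt; apply/negP => lt; apply: nf; exists f.
  have [x xB xmax] := att h hb; have [z zB] := hP x xB.
  by rewrite ltNge xmax.
have i0 n : 0 < n.+1%:R^-1 :> R by rewrite invr_gt0.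
have [y yP] := choice (fun n => near _ (i0 n)).
have yN n f : dual_ball N f -> `|F f - f (y n)| <= n.+1%:R^-1.
  move=> fb; rewrite ler_norml yP// andbT.
  have nfb : dual_ball N (-1 *: f).
    split; first by move=> t x z; rewrite !fctE fb.1 /GRing.scale/=; ring.
    move=> x; rewrite fctE /GRing.scale/= mulN1r -(seminormN N_seminorm).
    by rewrite -(scalarfN _ fb.1) fb.2.
  have := yP n _ nfb; rewrite (FZ _ (dual_ball_bdual fb)).
  rewrite (_ : (-1 *: f) (y n) = - f (y n)); last exact: scaleN1r.
  by move: (n.+1%:R^-1) => e; lra.
have [|z zP] := @N_complete y.
  (* A norming functional turns uniform closeness on the dual ball into closeness for [N]. *)
  move=> m n; have [f [sf fN <-]] :=
    hahn_banach (y m - y n) (seminorm_sublinear N_seminorm).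
  have fb : dual_ball N f by [].
  rewrite scalarfB//; have := yN m f fb; have := yN n f fb.
  move: (m.+1%:R^-1) (n.+1%:R^-1) => a b.
  by rewrite !ler_norml => /andP[? ?] /andP[? ?]; lra.
exists z.
have zb f : dual_ball N f -> F f = f z.
  move=> fb; apply/eqP; rewrite -subr_eq0 -normr_le0.
  apply/ler_addgt0Pr => e e0; rewrite add0r.
  have [n] := ltr_add_invr (divr_gt0 e0 (ltr0Sn R 1)).
  rewrite add0r => ne.
  have := yN n f fb; have := dual_ball_norm N_seminorm (y n - z) fb.
  have := zP n; rewrite (scalarfB _ _ fb.1).
  move: (n.+1%:R^-1) ne => a ne.
  rewrite !ler_norml => H /andP[? ?] /andP[? ?]; apply/andP; split; lra.
move=> f fb; have [C C0 fC] := bdual_ball N_seminorm fb.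
have := zb _ fC; rewrite FZ// fctE /GRing.scale/= => /mulfI; apply.
by rewrite invr_eq0 gt_eqF.
Qed.

End james.

(** * The averaging projection *)

Section mean.
Variables (K : numFieldType) (E : normedModType K).
Implicit Types (s : seq E) (S T : E).

Definition mean s : E := (size s)%:R^-1 *: \sum_(T <- s) T.

Lemma mean_dist_sum s S : s != [::] ->
  `|mean s - S| <= (size s)%:R^-1 * \sum_(T <- s) `|T - S|.
Proof.
move=> s0.
have n0 : (size s)%:R != 0 :> K by rewrite pnatr_eq0 size_eq0.
rewrite (_ : mean s - S = (size s)%:R^-1 *: \sum_(T <- s) (T - S)).
  by rewrite normrZ ger0_norm ?invr_ge0// ler_wpM2l ?invr_ge0// ler_norm_sum.
rewrite sumrB big_const_seq count_predT iter_addr_0.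
by rewrite scalerBr -[S *+ _]scaler_nat scalerA mulVf// scale1r.
Qed.

Lemma mean_dist s S r : s != [::] -> (forall T, T \in s -> `|T - S| <= r) ->
  `|mean s - S| <= r.
Proof.
move=> s0 sr; apply: le_trans (mean_dist_sum S s0) _.
rewrite ler_pdivrMl ?ltr0n ?lt0n ?size_eq0//.
rewrite big_seq; apply: le_trans (ler_sum _ sr) _.
by rewrite -big_seq big_const_seq count_predT iter_addr_0 mulr_natl.
Qed.

(** The source of the gain in [oscillation_improve]: one good term already lowers the average. *)
Lemma mean_dist_near s S A r e : A \in s -> `|A - S| <= e ->
  (forall T, T \in s -> `|T - S| <= r) ->
  `|mean s - S| <= r - (r - e) / (size s)%:R.
Proof.
move=> As Ae sr; have s0 : s != [::] by case: s As {sr}.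
have n0 : (size s)%:R != 0 :> K by rewrite pnatr_eq0 size_eq0.
apply: le_trans (mean_dist_sum S s0) _.
rewrite ler_pdivrMl ?ltr0n ?lt0n ?size_eq0//.
rewrite mulrBr mulrCA mulfV// mulr1 (perm_big _ (perm_to_rem As)) big_cons/=.
rewrite opprB addrCA lerD//.
have szs : (size s).-1.+1 = size s by rewrite prednK// lt0n size_eq0.
rewrite -[in (size s)%:R]szs -natr1 mulrDl mul1r addrK.
rewrite big_seq; apply: le_trans (ler_sum _ (fun T Tr => sr T (mem_rem Tr))) _.
by rewrite -big_seq big_const_seq count_predT iter_addr_0 size_rem// mulr_natl.
Qed.

End mean.

Lemma linear_mean (K : numFieldType) (E E' : normedModType K) (f : E -> E') s :
  linear f -> f (mean s) = mean (map f s).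
Proof.
move=> lf; pose L : {linear E -> E'} :=
  HB.pack f (GRing.isLinear.Build K E E' *:%R f lf).
by rewrite -[f]/(L : E -> E') /mean linearZ linear_sum size_map big_map.
Qed.

(* [K] is [R] or [R[i]], with [inj] the inclusion of the reals and [re] the real
   part. *)
Record real_part (R : realType) (K : scalarFieldType)
    (inj : {rmorphism R -> K}) (re : K -> R) : Prop := {
  inj_le : forall r s, (inj r <= inj s) = (r <= s);
  reD : forall z w, re (z + w) = re z + re w;
  re_inj : forall r z, re (inj r * z) = r * re z;
  ge0_re : forall z, 0 <= z -> inj (re z) = z;
  re_le_norm : forall z, re z <= re `|z|;
  complexification : forall (X : lmodType K) (u : X -> R),
    (forall x y, u (x + y) = u x + u y) ->
    (forall r x, u (inj r *: x) = r * u x) ->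
    exists2 f : X -> K, scalar f & forall x, re (f x) = u x
}.

Section real_part.
Variables (R : realType) (K : scalarFieldType) (inj : {rmorphism R -> K}).
Variables (re : K -> R) (KR : real_part inj re).

Lemma re_inj1 r : re (inj r) = r.
Proof.
have re1 : re 1 = 1.
  have := ge0_re KR ler01; rewrite -[RHS](rmorph1 inj); exact: fmorph_inj.
by rewrite -[inj r]mulr1 (re_inj KR) re1 mulr1.
Qed.

Lemma re_le z w : 0 <= z -> 0 <= w -> (re z <= re w) = (z <= w).
Proof. by move=> z0 w0; rewrite -(inj_le KR) !(ge0_re KR). Qed.

Lemma re0 : re 0 = 0.
Proof. by rewrite -(rmorph0 inj) re_inj1. Qed.

Lemma re_ge0 z : 0 <= z -> 0 <= re z.
Proof. by move=> z0; rewrite -re0 re_le. Qed.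

(** With [d := z - w], the factor [|d| / d] turns the difference into [|d|], which its real part
    determines. *)
Lemma re_norm_eq (z w : K) : (forall k, re (k * z) = re (k * w)) -> z = w.
Proof.
move=> zw; apply/eqP; rewrite -subr_eq0; set d := z - w; apply: contraT => d0.
have : re ((`|d| / d) * d) = 0.
  rewrite mulrBr -mulN1r -(rmorph1 inj) -rmorphN (reD KR) (re_inj KR) zw.
  by rewrite mulN1r subrr.
rewrite divfK// => e; have : `|d| = 0.
  by rewrite -(ge0_re KR (normr_ge0 d)) e rmorph0.
by move/eqP; rewrite normr_eq0 (negbTE d0).
Qed.

Lemma inj_lt r s : (inj r < inj s) = (r < s).
Proof. exact: leW_mono (inj_le KR) r s. Qed.

Lemma archi_small (c e : K) : 0 <= c -> 0 < e -> exists n0, forall n,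
  (n0 <= n)%N -> c * n.+1%:R^-1 < e.
Proof.
move=> c0 e0; rewrite -(ge0_re KR c0) -(ge0_re KR (ltW e0)).
have rc0 : 0 <= re c by exact: re_ge0.
have re0' : 0 < re e by rewrite -inj_lt rmorph0 (ge0_re KR (ltW e0)).
have c1 : 0 < re c + 1 by rewrite ltr_wpDl.
have [n0] := ltr_add_invr (divr_gt0 re0' c1).
rewrite add0r ltr_pdivlMr// => lt; exists n0 => n nn.
rewrite -(rmorph_nat inj) -fmorphV -rmorphM inj_lt.
have : n.+1%:R^-1 <= n0.+1%:R^-1 :> R by rewrite lef_pV2 ?posrE// ler_nat ltnS.
have : 0 < n.+1%:R^-1 :> R by rewrite invr_gt0.
by move: (n.+1%:R^-1) (n0.+1%:R^-1) lt => a b; nra.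
Qed.

Lemma archi_le (a b c : K) : 0 <= a -> 0 <= b -> 0 <= c ->
  (forall n, a <= b + c * n.+1%:R^-1) -> a <= b.
Proof.
move=> a0 b0 c0 h; rewrite -re_le// leNgt; apply/negP => ba.
have ab0 : 0 < inj (re a - re b) by rewrite -(rmorph0 inj) inj_lt subr_gt0.
have [n /(_ n (leqnn n))] := archi_small c0 ab0.
rewrite rmorphB !(ge0_re KR)// ltrBrDl => /(le_lt_trans (h n)).
by rewrite ltxx.
Qed.

Lemma archi_eq0 (X : normedModType K) (x : X) (c : K) : 0 <= c ->
  (forall n, `|x| <= c * n.+1%:R^-1) -> x = 0.
Proof.
move=> c0 xc; apply/eqP; rewrite -normr_le0; apply: (archi_le _ _ c0) => // n.
by rewrite add0r.
Qed.

Lemma cauchy_rate (X : completeNormedModType K) (y : nat -> X) (c : K) : 0 <= c ->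
  (forall m n, `|y m - y n| <= c * (m.+1%:R^-1 + n.+1%:R^-1)) ->
  exists z, forall n, `|y n - z| <= c * n.+1%:R^-1.
Proof.
move=> c0 yc.
have /cauchy_cvg/cvg_ex[z yz] : cauchy (y @ \oo).
  apply/cauchy_ballP => e e0.
  have [n0 n0P] := archi_small c0 (divr_gt0 e0 (ltr0Sn K 1)).
  exists ([set y n | n in [set n | (n0 <= n)%N]],
          [set y n | n in [set n | (n0 <= n)%N]]); first by split;
    exists n0 => // n nn; exists n.
  move=> _ [[m mm <-] [n nn <-]]; rewrite -ball_normE /=.
  apply: le_lt_trans (yc m n) _; rewrite mulrDr [ltRHS]splitr.
  by apply: ltrD; exact: n0P.
exists z => n; apply: (archi_le _ _ (c := c + 1)) => //.
- by rewrite mulr_ge0// invr_ge0.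
- exact: addr_ge0.
move=> k.
have k0 : 0 < k.+1%:R^-1 :> K by rewrite invr_gt0.
have /cvgrPdist_lt/(_ _ k0)[m0 _ m0P] := yz.
have ym := m0P (maxn m0 k) (leq_maxl _ _); rewrite distrC in ym.
have -> : y n - z = (y n - y (maxn m0 k)) + (y (maxn m0 k) - z).
  by rewrite addrA subrK.
apply: le_trans (ler_normD _ _) _.
rewrite [(c + 1) * _]mulrDl mul1r addrA; apply: lerD; last exact: ltW.
apply: le_trans (yc _ _) _; rewrite mulrDr lerD2l ler_wpM2l//.
by rewrite lef_pV2 ?posrE// ler_nat ltnS leq_maxr.
Qed.
End real_part.

Section bounded_operators.
Variables (K : scalarFieldType) (X Y Z : normedModType K).

Lemma bl_comp_linearl (h : boundedLinear X Y) :
  linear (fun T : boundedLinear Y Z => bl_comp T h).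
Proof. by move=> k S T; exact/val_inj/funext. Qed.

Lemma bl_comp_linearr (g : boundedLinear Y Z) :
  linear (fun T : boundedLinear X Y => bl_comp g T).
Proof. by move=> k S T; apply/val_inj/funext => x /=; rewrite linearP. Qed.

Lemma bl_norm_comp (g : boundedLinear Y Z) (h : boundedLinear X Y) :
  `|bl_comp g h| <= `|g| * `|h|.
Proof.
apply: opnorm_le => [|x]; first by rewrite mulr_ge0.
rewrite -mulrA; apply: le_trans (ler_bl_norm g (h x)) _.
by rewrite ler_wpM2l// ler_bl_norm.
Qed.

End bounded_operators.

(** * Convex averages over the compact group *)

Section group.
Variables (R : realType) (K : scalarFieldType) (inj : {rmorphism R -> K}).
Variables (re : K -> R) (KR : real_part inj re).
Variables (X : completeNormedModType K) (G : set (boundedLinear X X)).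
Hypothesis GG : compact_isometry_group G.
Local Notation E := (boundedLinear X X).
Implicit Types (g h : E) (S T : E).

Lemma group_norm g : G g -> `|g| <= 1.
Proof.
by move=> Gg; apply: opnorm_le => // x; rewrite mul1r (group_isometry GG).
Qed.

Definition act g h T : E := bl_comp g (bl_comp T h).

Lemma act_linear g h : linear (act g h).
Proof. by move=> k S T; rewrite /act bl_comp_linearl bl_comp_linearr. Qed.

Lemma act_comp a b g h T : act a b (act g h T) = act (bl_comp a g) (bl_comp h b) T.
Proof. exact: val_inj. Qed.

Lemma act1 T : act (bl_id X) (bl_id X) T = T.
Proof. exact: val_inj. Qed.

Lemma actB g h S T : act g h (S - T) = act g h S - act g h T.
Proof. by have := act_linear g h (-1) T S; rewrite !scaleN1r ![- _ + _]addrC. Qed.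

Lemma act_norm g h T : G g -> G h -> `|act g h T| <= `|T|.
Proof.
move=> Gg Gh; apply: opnorm_le => // x.
by rewrite /= (group_isometry GG Gg) -(group_isometry GG Gh x) ler_bl_norm.
Qed.

(* The convex hull of [G], with averages of finite families as the only
   convex combinations. *)
Definition hull : set E := [set T | forall A : set E, G `<=` A ->
  (forall s, s != [::] -> (forall T, T \in s -> A T) -> A (mean s)) -> A T].

Lemma sub_hull : G `<=` hull. Proof. by move=> g Gg A GA _; exact: GA. Qed.

Lemma hull_mean s : s != [::] -> (forall T, T \in s -> hull T) -> hull (mean s).
Proof. by move=> s0 sh A GA Am; apply: (Am) => // T Ts; exact: (sh T Ts A GA Am). Qed.

Lemma hull_norm T : hull T -> `|T| <= 1.
Proof.
move=> /(_ [set T | `|T| <= 1]); apply; first by move=> g; exact: group_norm.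
move=> s s0 sA /=; rewrite -[mean s]subr0; apply: mean_dist => // S /sA /=.
by rewrite subr0.
Qed.

Lemma hull_act g h T : G g -> G h -> hull T -> hull (act g h T).
Proof.
move=> Gg Gh /(_ [set T | hull (act g h T)]); apply.
  by move=> f Gf; apply: sub_hull; exact: (group_comp GG Gg (group_comp GG Gf Gh)).
move=> s s0 sA /=; rewrite (linear_mean _ (act_linear g h)).
apply: hull_mean; first by case: s s0 {sA}.
by move=> _ /mapP[S Ss ->]; exact: sA.
Qed.

Lemma hull_fix (Z : normedModType K) (f : E -> Z) (z : Z) T : linear f ->
  (forall g, G g -> f g = z) -> hull T -> f T = z.
Proof.
move=> lf fz /(_ [set T | f T = z]); apply=> // s s0 sA /=.
rewrite (linear_mean _ lf); apply/eqP; rewrite -subr_eq0 -normr_le0.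
apply: mean_dist; first by case: s s0 {sA}.
by move=> _ /mapP[S /sA /= -> ->]; rewrite subrr normr0.
Qed.

Lemma hull_contract (f : E -> E) (S : E) r T : linear f ->
  (forall g, G g -> `|f g - S| <= r) -> hull T -> `|f T - S| <= r.
Proof.
move=> lf fz /(_ [set T | `|f T - S| <= r]); apply=> // s s0 sA /=.
rewrite (linear_mean _ lf); apply: mean_dist; first by case: s s0 {sA}.
by move=> _ /mapP[U /sA /= ? ->].
Qed.

Definition oscillation_le T r := forall g h g' h', G g -> G h -> G g' -> G h' ->
  `|act g h T - act g' h' T| <= r.

Lemma group_net (e : K) : 0 < e -> exists2 s : seq E,
  (forall g, g \in s -> G g) &
  forall g, G g -> exists2 h, h \in s & `|g - h| <= e.
Proof.
move=> e0; have := group_compact GG; rewrite compact_cover.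
move=> /(_ E G (fun h => ball h e)) [|g Gg|D DG cov].
- by move=> h _; exact: ball_open.
- by exists g => //; exact: ballxx.
exists (enum_fset D) => [g gD|g /cov[h /= hD]].
  exact/set_mem/DG.
by rewrite -ball_normE /= distrC => /ltW ge; exists h.
Qed.

(** The terms of [act g h (mean l)] are all within [r] of [act g' h' T], and one is within [e + e]:
    take [p] near the inverse of [g] times [g'], and [q] near [h'] times the inverse of [h]. *)
Lemma oscillation_improve (s : seq E) (e r : K) T : 0 <= r ->
  (forall g, g \in s -> G g) ->
  (forall g, G g -> exists2 h, h \in s & `|g - h| <= e) ->
  hull T -> oscillation_le T r ->
  exists2 T', hull T' &
    oscillation_le T' (r - (r - (e + e)) / (size s * size s)%:R).
Proof.
move=> r0 sG snet hT oT.
set l := [seq act p q T | p <- s, q <- s].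
have [p0 p0s _] := snet _ (group_id GG).
have l0 : l != [::].
  rewrite -size_eq0 size_allpairs muln_eq0 orbb size_eq0.
  by case: s p0s {sG snet l}.
have orbit g h g' h' : G g -> G h -> G g' -> G h' ->
    `|act g h (mean l) - act g' h' T| <= r - (r - (e + e)) / (size s * size s)%:R.
  move=> Gg Gh Gg' Gh'; rewrite (linear_mean _ (act_linear g h)).
  have [gi Ggi [ggi gig]] := group_inv GG Gg.
  have [hi Ghi [hhi hih]] := group_inv GG Gh.
  have [p ps pe] := snet _ (group_comp GG Ggi Gg').
  have [q qs qe] := snet _ (group_comp GG Gh' Ghi).
  have -> : (size s * size s)%N = size (map (act g h) l).
    by rewrite size_map size_allpairs.
  apply: (@mean_dist_near _ _ _ _ (act g h (act p q T))).
  - by apply: map_f; apply: allpairs_f.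
  - have -> : act g' h' T = act g h (act (bl_comp gi g') (bl_comp h' hi) T).
      apply/val_inj/funext => x /=.
      have /(congr1 val)/(congr1 (fun f => f (g' (T (h' x))))) /= := ggi.
      have /(congr1 val)/(congr1 (fun f => f x)) /= := hih.
      by move=> -> ->.
    rewrite -actB; apply: le_trans (act_norm _ Gg Gh) _.
    set a := bl_comp gi g'; set b := bl_comp h' hi.
    have -> : act p q T - act a b T = bl_comp (p - a) (bl_comp T q) +
        bl_comp a (bl_comp T (q - b)).
      apply/val_inj/funext => x.
      by rewrite /= !fctE/= !linearB/= subrKA.
    have Tq : `|bl_comp T q| <= 1.
      apply: le_trans (bl_norm_comp _ _) _; rewrite -[leRHS]mulr1.
      by apply: ler_pM => //; [exact: hull_norm|apply: group_norm; exact: sG].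
    have aT : `|bl_comp a T| <= 1.
      apply: le_trans (bl_norm_comp _ _) _; rewrite -[leRHS]mulr1.
      apply: ler_pM => //; last exact: hull_norm.
      by apply: group_norm; exact: (group_comp GG).
    apply: le_trans (ler_normD _ _) _; apply: lerD.
      apply: le_trans (bl_norm_comp _ _) _; rewrite -[leRHS]mulr1.
      by apply: ler_pM => //; rewrite distrC.
    have -> : bl_comp a (bl_comp T (q - b)) = bl_comp (bl_comp a T) (q - b).
      exact: val_inj.
    apply: le_trans (bl_norm_comp _ _) _; rewrite -[leRHS]mul1r.
    by apply: ler_pM => //; rewrite distrC.
  - move=> _ /mapP[_ /allpairsP[[u v] /= [us vs ->]] ->].
    by rewrite act_comp; apply: oT => //; apply: (group_comp GG) => //; exact: sG.
exists (mean l).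
  apply: hull_mean => // _ /allpairsP[[u v] /= [us vs ->]].
  by apply: hull_act => //; exact: sG.
move=> g h g' h' Gg Gh Gg' Gh'.
(* The second copy of [mean l] is again an average of orbit points of [T], each covered by
   [orbit]. *)
rewrite distrC; have := @mean_dist _ _ (map (act g' h') l) (act g h (mean l)).
rewrite -(linear_mean _ (act_linear g' h')); apply; first by case: l l0 {orbit}.
move=> _ /mapP[_ /allpairsP[[u v] /= [us vs ->]] ->].
rewrite act_comp distrC; apply: orbit => //.
  by apply: (group_comp GG) => //; exact: sG.
by apply: (group_comp GG) => //; exact: sG.
Qed.


Lemma oscillation_small (e : R) : 0 < e ->
  exists2 T, hull T & oscillation_le T (inj e).
Proof.
move=> e0; apply: contrapT => nT.
pose S := [set r : R | 0 <= r /\ exists2 T, hull T & oscillation_le T (inj r)].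
have Se r : S r -> e <= r.
  move=> [r0 [T hT oT]]; rewrite leNgt; apply/negP => re'; apply: nT; exists T => //.
  move=> g h g' h' Gg Gh Gg' Gh'; apply: le_trans (oT g h g' h' Gg Gh Gg' Gh') _.
  by rewrite (inj_le KR) ltW.
have S0 : S !=set0.
  exists 2; split=> //; exists (bl_id X); first exact: (sub_hull (group_id GG)).
  move=> g h g' h' Gg Gh Gg' Gh'; rewrite rmorph_nat.
  have id1 := group_norm (group_id GG).
  apply: le_trans (ler_normB _ _) _; rewrite -[2%:R]/(1 + 1).
  by apply: lerD; apply: le_trans id1; exact: act_norm.
have hS : has_inf S by split=> //; exists e.
(* The net is fixed before [r], so [m] does not depend on [r]. Since [e <= r], the improvement is at
   least [e / 2 / m], and an [r] closer than that to the infimum gives a contradiction. *)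
have e4 : 0 < inj (e / 4) by rewrite -(rmorph0 inj) (inj_lt KR) divr_gt0.
have [s sG snet] := group_net e4.
pose m : R := (size s * size s)%:R.
have m1 : 1 <= m.
  have [p ps _] := snet _ (group_id GG).
  by rewrite /m ler1n muln_gt0 andbb lt0n size_eq0; case: s ps {sG snet m}.
have m0 : 0 < m by exact: lt_le_trans m1.
have em0 : 0 < e / 2 / m by rewrite !divr_gt0.
have [r Sr rlt] := inf_adherent em0 hS.
have re' := Se r Sr; have [r0 [T hT oT]] := Sr.
have ir0 : 0 <= inj r by rewrite -(rmorph0 inj) (inj_le KR).
have [T' hT' oT'] := oscillation_improve ir0 sG snet hT oT.
have : S (r - (r - e / 2) / m).
  split.
    rewrite subr_ge0 ler_pdivrMr//; apply: le_trans (_ : r <= _).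
      by rewrite gerBl divr_ge0// ltW.
    by rewrite -[leLHS]mulr1 ler_wpM2l.
  exists T' => //; rewrite rmorphB rmorphM rmorphB fmorphV rmorph_nat.
  by rewrite (_ : e / 2 = e / 4 + e / 4) ?rmorphD//; field.
move=> /(ge_inf hS.2); apply/negP; rewrite -ltNge.
apply: (@le_lt_trans _ _ (r - e / 2 / m)); last by rewrite ltrBlDr.
by rewrite lerD2l lerN2 ler_pM2r ?invr_gt0//; lra.
Qed.

(** The last clause uses that [P] is a norm limit of elements of the hull. Its target is arbitrary
    because it serves for [T x], [f (T x)] and [F (bl_comp f T)] as functions of [T]. *)
Lemma averaging_projection : exists P : E,
  [/\ `|P| <= 1, forall g, G g -> bl_comp g P = P,
      forall g, G g -> bl_comp P g = P &
      forall (Z : normedModType K) (f : E -> Z) (z : Z) (c : K), linear f ->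
        0 <= c -> (forall T, `|f T| <= c * `|T|) ->
        (forall g, G g -> f g = z) -> f P = z].
Proof.
have rate_gt0 n : 0 < n.+1%:R^-1 :> K by rewrite invr_gt0.
have T_ex n : exists T, hull T /\ oscillation_le T n.+1%:R^-1.
  have [|T hT oT] := @oscillation_small n.+1%:R^-1; first by rewrite invr_gt0.
  by exists T; split=> //; rewrite fmorphV rmorph_nat in oT.
have [T_ T_P] := choice T_ex.
have T_hull n : hull (T_ n) := (T_P n).1.
have actT n g h : G g -> G h -> `|act g h (T_ n) - T_ n| <= n.+1%:R^-1.
  move=> Gg Gh; rewrite -{2}(act1 (T_ n)).
  by apply: (T_P n).2 => //; exact: (group_id GG).
have lT n g : G g -> `|bl_comp g (T_ n) - T_ n| <= n.+1%:R^-1.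
  move=> Gg; have := actT n g _ Gg (group_id GG).
  by rewrite (_ : act _ _ _ = bl_comp g (T_ n))//; exact: val_inj.
have rT n g : G g -> `|bl_comp (T_ n) g - T_ n| <= n.+1%:R^-1.
  move=> Gg; have := actT n _ g (group_id GG) Gg.
  by rewrite (_ : act _ _ _ = bl_comp (T_ n) g)//; exact: val_inj.
have TT m n : `|T_ m - T_ n| <= m.+1%:R^-1 + n.+1%:R^-1.
  (* [T_ m] nearly absorbs group elements on its right, hence also the hull element [T_ n];
     symmetrically for [T_ n] on its left. *)
  rewrite -(subrKA (bl_comp (T_ m) (T_ n))).
  apply: le_trans (ler_normD _ _) (lerD _ _).
    rewrite distrC; apply: (@hull_contract (fun T => bl_comp (T_ m) T)) => //.
    - exact: bl_comp_linearr.
    - by move=> g; exact: rT.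
  apply: (@hull_contract (fun T => bl_comp T (T_ n))) => //.
  - exact: bl_comp_linearl.
  - by move=> g; exact: lT.
(* The limit is taken pointwise in [X]; the rate, uniform on the ball, makes it a limit in operator
   norm in [TP]. *)
have P_ex x : exists z, forall n, `|T_ n x - z| <= `|x| * n.+1%:R^-1.
  apply: (cauchy_rate KR) => // m n.
  by rewrite mulrC; apply: le_trans (ler_bl_norm (T_ m - T_ n) x) _; rewrite ler_wpM2r.
have [P0 P0P] := choice P_ex.
have P0lin : linear P0.
  move=> k x y; apply/eqP; rewrite -subr_eq0; apply/eqP.
  apply: (@archi_eq0 _ _ _ _ KR _ _ (`|k *: x + y| + (`|k| * `|x| + `|y|))) => [|n].
    by rewrite !addr_ge0// mulr_ge0.
  rewrite -(subrKA (T_ n (k *: x + y))) mulrDl.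
  apply: le_trans (ler_normD _ _) (lerD _ _); first by rewrite distrC.
  rewrite linearP/= opprD addrACA -scalerBr mulrDl.
  apply: le_trans (ler_normD _ _) (lerD _ _) => //.
  by rewrite normrZ -mulrA ler_wpM2l.
have P0norm x : `|P0 x| <= 1 * `|x|.
  rewrite mul1r; apply: (@archi_le _ _ _ _ KR _ _ `|x|) => // n.
  rewrite -[P0 x](subrK (T_ n x)) addrC; apply: le_trans (ler_normD _ _) (lerD _ _).
    apply: le_trans (ler_bl_norm _ _) _.
    by rewrite -[leRHS]mul1r ler_wpM2r// hull_norm.
  by rewrite distrC.
pose P : E := BoundedLinear (bound_bounded_linear P0lin ler01 P0norm).
have TP n : `|T_ n - P| <= n.+1%:R^-1.
  by apply: opnorm_le => [|x]; [exact: ltW|rewrite mulrC; exact: P0P].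
exists P; split.
- exact: opnorm_le.
- move=> g Gg; apply/eqP; rewrite -subr_eq0; apply/eqP.
  apply: (@archi_eq0 _ _ _ _ KR _ _ (1 + (1 + 1))) => // n.
  rewrite -(subrKA (bl_comp g (T_ n))) !mulrDl mul1r.
  apply: le_trans (ler_normD _ _) (lerD _ _).
    have -> : bl_comp g P - bl_comp g (T_ n) = bl_comp g (P - T_ n).
      by apply/val_inj/funext => x; rewrite /= linearB.
    apply: le_trans (bl_norm_comp _ _) _; rewrite -[leRHS]mul1r.
    by apply: ler_pM => //; [exact: group_norm|rewrite distrC].
  rewrite -(subrKA (T_ n)); apply: le_trans (ler_normD _ _) (lerD _ _) => //.
  exact: lT.
- move=> g Gg; apply/eqP; rewrite -subr_eq0; apply/eqP.
  apply: (@archi_eq0 _ _ _ _ KR _ _ (1 + (1 + 1))) => // n.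
  rewrite -(subrKA (bl_comp (T_ n) g)) !mulrDl mul1r.
  apply: le_trans (ler_normD _ _) (lerD _ _).
    have -> : bl_comp P g - bl_comp (T_ n) g = bl_comp (P - T_ n) g.
      exact/val_inj/funext.
    apply: le_trans (bl_norm_comp _ _) _; rewrite -[leRHS]mulr1.
    by apply: ler_pM => //; [rewrite distrC|exact: group_norm].
  rewrite -(subrKA (T_ n)); apply: le_trans (ler_normD _ _) (lerD _ _) => //.
  exact: rT.
- move=> Z f z c lf c0 fc fz; apply/eqP; rewrite -subr_eq0; apply/eqP.
  apply: (@archi_eq0 _ _ _ _ KR _ _ c) => // n.
  rewrite -(hull_fix lf fz (T_hull n)).
  have -> : f P - f (T_ n) = f (P - T_ n).
    by have := lf (-1) (T_ n) P; rewrite !scaleN1r ![- _ + _]addrC.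
  by apply: le_trans (fc _) _; rewrite ler_wpM2l// distrC.
Qed.

End group.

(** * Real and complex scalars *)

Section realform.
Variables (R : realType) (K : scalarFieldType) (inj : {rmorphism R -> K}).

(* [X] with scalars restricted along [inj], which is an argument only to make
   the module structure inferable. *)
Definition realform (_ : {rmorphism R -> K}) (X : lmodType K) : Type := X.

Variable X : lmodType K.

HB.instance Definition _ := GRing.Zmodule.copy (realform inj X) X.

Let scale (r : R) (x : realform inj X) : realform inj X := inj r *: (x : X).

Fact realform_scalerA r s x : scale r (scale s x) = scale (r * s) x.
Proof. by rewrite /scale scalerA rmorphM. Qed.

Fact realform_scale1r : left_id 1 scale.
Proof. by move=> x; rewrite /scale rmorph1 scale1r. Qed.

Fact realform_scalerDr : right_distributive scale +%R.
Proof. by move=> r x y; rewrite /scale scalerDr. Qed.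

Fact realform_scalerDl x : {morph scale^~ x : r s / r + s}.
Proof. by move=> r s; rewrite /scale rmorphD scalerDl. Qed.

HB.instance Definition _ := GRing.Zmodule_isLmodule.Build R (realform inj X)
  realform_scalerA realform_scale1r realform_scalerDr realform_scalerDl.

Lemma realform_scaleE (r : R) (x : realform inj X) : r *: x = inj r *: (x : X).
Proof. by []. Qed.

End realform.

(** * Functionals and their real parts *)

Section real_functionals.
Variables (R : realType) (K : scalarFieldType) (inj : {rmorphism R -> K}).
Variables (re : K -> R) (KR : real_part inj re).

Lemma re_normZ (Y : normedModType K) (r : R) (y : Y) :
  re `|inj r *: y| = `|r| * re `|y|.
Proof.
have injn : `|inj r| = inj `|r|.
  have [r0|r0] := leP 0 r.
    by rewrite !ger0_norm// -(rmorph0 inj) (inj_le KR).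
  by rewrite !ltr0_norm ?rmorphN// -(rmorph0 inj) (inj_lt KR).
by rewrite normrZ injn (re_inj KR).
Qed.

Lemma re_norm_seminorm (X : lmodType K) (Y : normedModType K)
    (L : {linear X -> Y}) :
  seminorm (fun x : realform inj X => re `|L (x : X)|).
Proof.
split=> [x y|r x].
  rewrite -(reD KR) (re_le KR) ?addr_ge0//.
  by rewrite -[x + y]/((x : X) + (y : X)) linearD ler_normD.
by rewrite realform_scaleE linearZ re_normZ.
Qed.

Lemma complexify (X : lmodType K) (u : realform inj X -> R) : scalar u ->
  exists2 f : X -> K, scalar f & forall x : X, re (f x) = u x.
Proof.
move=> su; apply: (complexification KR) => [x y|r x].
  by have := su 1 x y; rewrite scale1r mul1r.
exact: (scalarfZ r (x : realform inj X) su).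
Qed.

(** Multiplying [x] by the unimodular scalar [|f x| / f x] makes the value of [f] its own modulus,
    to which the bound on [u] applies. *)
Lemma complexify_norm (X Y : normedModType K) (L : {linear X -> Y})
  (u : realform inj X -> R) (f : X -> K) (c : K) : scalar f -> 0 <= c ->
  (forall x : X, re (f x) = u x) -> (forall x : X, u x <= re (c * `|L x|)) ->
  forall x, `|f x| <= c * `|L x|.
Proof.
move=> sf c0 fu uc x; have [->|f0] := eqVneq (f x) 0.
  by rewrite normr0 mulr_ge0.
rewrite -(re_le KR) ?mulr_ge0//; pose a := `|f x| / f x.
have a1 : `|a| = 1.
  by rewrite normrM normr_id normfV mulfV// normr_eq0.
have <- : f (a *: x) = `|f x|.
  have := sf a x 0; rewrite !addr0 (_ : f 0 = 0) ?addr0.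
    by move=> ->; rewrite divfK.
  have := sf 1 0 0; rewrite scale1r addr0 mul1r => e.
  by apply: (@addrI _ (f 0)); rewrite -e addr0.
by rewrite fu; apply: le_trans (uc _) _; rewrite linearZ normrZ a1 mul1r.
Qed.

Lemma norming_functional (Y : normedModType K) (y : Y) :
  exists2 F : dual Y, `|F| <= 1 & F y = `|y|.
Proof.
have [u [su ule uy]] := hahn_banach (y : realform inj Y)
  (seminorm_sublinear (re_norm_seminorm (idfun : {linear Y -> Y}))).
have [f sf fu] := complexify su.
have f1 x : `|f x| <= 1 * `|x|.
  apply: (@complexify_norm Y Y (idfun : {linear Y -> Y}) u f 1) => // z.
  by rewrite mul1r; exact: ule.
pose F : dual Y := BoundedLinear (@bound_bounded_linear K Y K^o f 1 sf ler01 f1).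
have F1 : `|F| <= 1 by exact: opnorm_le.
have Fy : `|F y| = `|y|.
  apply/le_anti; rewrite -[leRHS]mul1r (f1 y)/=.
  by rewrite -(re_le KR)// -uy -[u y]fu (re_le_norm KR).
have [y0|y0] := eqVneq `|y| 0.
  by exists F => //; apply/eqP; rewrite y0 -normr_eq0 Fy y0.
have Fy0 : F y != 0 by rewrite -normr_eq0 Fy.
exists ((`|F y| / F y) *: F).
  by rewrite normrZ normrM normr_id normfV mulfV ?mul1r// normr_eq0.
by rewrite -[LHS]/((`|F y| / F y) * F y) divfK.
Qed.

End real_functionals.

(** * The two implications, given the averaging projection *)

Section reflexivity.
Variables (R : realType) (K : scalarFieldType) (inj : {rmorphism R -> K}).
Variables (re : K -> R) (KR : real_part inj re).
Variables (X : completeNormedModType K) (G : set (boundedLinear X X)).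

Variable P : boundedLinear X X.
Hypothesis P_norm : `|P| <= 1.
Hypothesis groupP : forall g, G g -> bl_comp g P = P.
Hypothesis P_group : forall g, G g -> bl_comp P g = P.
Hypothesis P_fix : forall (Z : normedModType K) (f : boundedLinear X X -> Z)
  (z : Z) (c : K), linear f -> 0 <= c -> (forall T, `|f T| <= c * `|T|) ->
  (forall g, G g -> f g = z) -> f P = z.

Lemma P_le x : `|P x| <= `|x|.
Proof.
apply: le_trans (ler_bl_norm P x) _.
by rewrite -[leRHS]mul1r ler_wpM2r.
Qed.

Lemma P_invariants x : invariants G x -> P x = x.
Proof.
move=> Gx; apply: (@P_fix X (fun T => T x) x `|x|) => //.
by move=> T; rewrite mulrC ler_bl_norm.
Qed.

Lemma invariants_P x : invariants G (P x).
Proof. by move=> g Gg; rewrite -[in RHS](groupP Gg). Qed.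

Lemma dual_invariants_P (f : dual X) x : dual_invariants G f -> f (P x) = f x.
Proof.
move=> Gf; apply: (@P_fix K^o (fun T => f (T x)) (f x) (`|f| * `|x|)).
- by move=> k S T; rewrite /= linearP.
- exact: mulr_ge0.
- move=> T; apply: le_trans (ler_bl_norm f (T x)) _.
  by rewrite -mulrA ler_wpM2l// mulrC ler_bl_norm.
- by move=> g; exact: Gf.
Qed.

Lemma bidual_invariants_P (F : dual (dual X)) (f : dual X) :
  bidual_invariants G F -> F (bl_comp f P) = F f.
Proof.
move=> GF; apply: (@P_fix K^o (fun T => F (bl_comp f T)) (F f) (`|F| * `|f|)).
- by move=> k S T; rewrite /= bl_comp_linearr linearP.
- exact: mulr_ge0.
- move=> T; apply: le_trans (ler_bl_norm F (bl_comp f T)) _.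
  by rewrite -mulrA ler_wpM2l// bl_norm_comp.
- by move=> g /GF {2}<-.
Qed.

(** For [f] nonzero, compose a functional [F] norming [f] with the adjoint of [P]. The result is
    invariant, hence the evaluation at some [x] in the ball, and [f x = F f]. For [f = 0] any unit
    vector serves, whence the nonzero [x0]. *)
Lemma norm_attaining_of_reflexive : (exists x : X, x != 0) ->
  group_reflexive G ->
  forall f : dual X, dual_invariants G f -> norm_attaining f.
Proof.
move=> [x0 x00] GR f Gf.
have [f0|f0] := eqVneq f 0.
  exists (`|x0|^-1 *: x0); split.
    by rewrite normrZ normfV normr_id mulVf// normr_eq0.
  by rewrite f0 normr0.
have [F F1 Ff] := norming_functional KR f.
have : bidual_invariants G (bl_comp F (adjoint P)).
  move=> g Gg; apply/val_inj/funext => h.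
  rewrite -[LHS]/(F (bl_comp (bl_comp h g) P)) -[RHS]/(F (bl_comp h P)).
  congr (F _); rewrite -{2}(groupP Gg); exact: val_inj.
rewrite -GR => -[x Gx xF].
have xE (h : dual X) : h x = F (bl_comp h P).
  by rewrite -[RHS]/(bl_comp F (adjoint P) h) -xF.
have fx : f x = `|f|.
  rewrite xE -Ff; congr (F _); apply/val_inj/funext => z.
  exact: dual_invariants_P.
exists x; split=> //; apply/le_anti/andP; split.
  have [h h1 hx] := norming_functional KR x; rewrite -(normr_id x) -hx xE.
  have hP : `|bl_comp h P| <= 1.
    apply: le_trans (bl_norm_comp _ _) _; rewrite -[leRHS]mulr1.
    exact: ler_pM.
  apply: le_trans (ler_bl_norm _ _) _; rewrite -[leRHS]mulr1.
  exact: ler_pM.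
have fn0 : 0 < `|f| by rewrite normr_gt0.
rewrite -(ler_pM2l fn0) mulr1; apply: le_trans (ler_bl_norm f x).
by rewrite fx normr_id.
Qed.

Let N (x : realform inj X) : R := re `|P (x : X)|.

Let N_seminorm : seminorm N.
Proof. exact: (re_norm_seminorm KR (bl_fun P : {linear X -> X})). Qed.

(** James' theorem for [N]: [c] turns an [N]-bounded real functional into the invariant functional
    with that real part, through which [F] acts on real functionals. *)
Lemma reflexive_of_norm_attaining :
  (forall f : dual X, dual_invariants G f -> norm_attaining f) ->
  group_reflexive G.
Proof.
move=> att; apply/seteqP; split=> [_ [x Gx <-] g Gg|F GF].
  apply/val_inj/funext => f; rewrite -[LHS]/(f (g x)) -[RHS]/(f x).
  by rewrite Gx.
have ex u : exists f : dual X, bdual N u -> forall x : X, re (f x) = u x.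
  have [[su [C uC]]|nu] := pselect (bdual N u); last by exists 0.
  have [f sf fu] := complexify KR su.
  have C0 : 0 <= inj `|C| by rewrite -(rmorph0 inj) (inj_le KR).
  have fC x : `|f x| <= inj `|C| * `|P x|.
    apply: (complexify_norm KR (L := (bl_fun P : {linear X -> X})) sf C0 fu) => z.
    apply: le_trans (uC z) _; rewrite (re_inj KR) ler_wpM2r ?ler_norm//.
    exact: (re_ge0 KR).
  have fC' x : `|f x| <= inj `|C| * `|x|.
    by apply: le_trans (fC x) _; rewrite ler_wpM2l// P_le.
  by exists (BoundedLinear (@bound_bounded_linear K X K^o f _ sf C0 fC')).
have [c cP] := choice ex.
have mulE (h : dual X) k x : k * h x = h (k *: x) by rewrite linearZ.
have c_uniq u (f : dual X) : bdual N u -> (forall x : X, re (f x) = u x) -> c u = f.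
  move=> bu fu; apply/val_inj/funext => x; apply: (re_norm_eq KR) => k.
  by rewrite !mulE cP// fu.
have c_lin f g t : bdual N f -> bdual N g ->
    c (t *: f + g) = inj t *: c f + c g.
  move=> bf bg; apply: c_uniq; first exact: bdual_lin.
  move=> x; rewrite -[X in re X]/(inj t * c f x + c g x).
  by rewrite (reD KR) (re_inj KR) !cP.
(* As [P] absorbs [g], the seminorm [N] vanishes on [g y - y], and so does every [N]-bounded
   functional. *)
have c_inv u : bdual N u -> dual_invariants G (c u).
  move=> bu x g Gg; apply: (re_norm_eq KR) => k.
  rewrite !mulE !cP// (_ : k *: g x = g (k *: x)); last by rewrite linearZ.
  have [su [C uC]] := bu.
  have N0 y : N (g y - y) = 0.
    rewrite /N linearB/= -[X in X - _]/(bl_comp P g y) P_group// subrr normr0.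
    exact: (re0 KR).
  apply/eqP; rewrite -subr_eq0.
  rewrite -(scalarfB (g (k *: x) : realform inj X) (k *: x : X) su).
  apply/eqP/le_anti.
  have := uC (g (k *: x) - k *: x); have := uC (- (g (k *: x) - k *: x)).
  rewrite scalarfN// (seminormN N_seminorm) N0 mulr0 oppr_le0 => H1 H2.
  by rewrite H1 H2.
pose Phi (u : realform inj X -> R) : R := re (F (c u)).
(* The added 1 keeps the bound positive even when [F] is zero. *)
have [|||||x xP] := @james R (realform inj X) N N_seminorm Phi (re `|F| + 1).
- move=> f g t bf bg; rewrite /Phi c_lin// linearP/= (reD KR).
  by rewrite -[_ *: _]/(inj t * F (c f)) (re_inj KR).
- by rewrite ltr_wpDl// (re_ge0 KR).
- move=> u bu; have [su uN] := bu; rewrite /Phi.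
  have cu1 : `|c u| <= 1.
    apply: opnorm_le => // x; apply: le_trans (_ : 1 * `|P x| <= _); last first.
      by rewrite !mul1r P_le.
    apply: (complexify_norm KR (L := (bl_fun P : {linear X -> X})) (u := u)) => //.
    - by move=> k y z; rewrite linearP.
    - exact: cP (dual_ball_bdual bu).
    - by move=> y; rewrite mul1r; exact: uN.
  apply: le_trans (re_le_norm KR _) _; apply: ler_wpDr => //.
  rewrite (re_le KR)//; apply: le_trans (ler_bl_norm F (c u)) _.
  by rewrite -[leRHS]mulr1 ler_wpM2l.
(* Completeness of [N]: the [P (y n)] converge in [X] to some [z], and
   [P (y n) - P z = P (P (y n) - z)] is no longer than [P (y n) - z]. *)
- move=> y yc.
  have nat_inv n : inj n.+1%:R^-1 = n.+1%:R^-1 by rewrite fmorphV rmorph_nat.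
  have [|m n|z zP] := @cauchy_rate _ _ _ _ KR X (fun n => P (y n)) 1 => //.
    rewrite mul1r -linearB -(ge0_re KR (normr_ge0 _)) -!nat_inv -rmorphD (inj_le KR).
    exact: yc.
  exists z => n; rewrite /N -(inj_le KR) (ge0_re KR)// nat_inv -[leRHS]mul1r.
  apply: le_trans (zP n).
  rewrite linearB/= -[X in X - _](P_invariants (@invariants_P (y n))) -linearB.
  exact: P_le.
- move=> u bu; have [x [x1 xc]] := att _ (c_inv u bu); exists x.
    have : `|P x| <= 1 by rewrite -x1 P_le.
    by rewrite -(re_le KR)// -(rmorph1 inj) (re_inj1 KR).
  move=> y yN; rewrite -(cP u bu) -(cP u bu) xc -(dual_invariants_P y (c_inv u bu)).
  apply: le_trans (re_le_norm KR _) _; rewrite (re_le KR)//.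
  apply: le_trans (ler_bl_norm _ _) _; rewrite -[leRHS]mulr1 ler_wpM2l//.
  by rewrite -(re_le KR)// -(rmorph1 inj) (re_inj1 KR).
exists (P x); first exact: invariants_P.
apply/val_inj/funext => f; rewrite -[LHS]/(f (P x)) -[RHS]/(F f).
rewrite -(bidual_invariants_P f GF); apply: (re_norm_eq KR) => k.
(* The functionals [bl_comp (k *: f) P] for all scalars [k] recover the full value of [F] from real
   parts. *)
pose u (y : realform inj X) := re ((k *: f) (P (y : X))).
have bu : bdual N u.
  split.
    move=> r y z; rewrite /u realform_scaleE.
    rewrite -[r *: y + z]/(inj r *: (y : X) + (z : X)) !linearP/=.
    by rewrite (reD KR) -[_ *: _]/(inj r * _) (re_inj KR).
  exists (re `|k *: f|) => y; rewrite /u.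
  apply: le_trans (re_le_norm KR _) _; rewrite -(re_inj KR) (ge0_re KR)//.
  by rewrite (re_le KR) ?mulr_ge0// ler_bl_norm.
have cu : c u = bl_comp (k *: f) P by exact: c_uniq.
have := xP u bu; rewrite /Phi cu /u.
rewrite (_ : bl_comp (k *: f) P = k *: bl_comp f P); last exact: val_inj.
by rewrite linearZ.
Qed.

End reflexivity.

Theorem group_james (R : realType) (K : scalarFieldType)
    (inj : {rmorphism R -> K}) (re : K -> R) (X : completeNormedModType K)
    (G : set (boundedLinear X X)) : real_part inj re ->
  (exists x : X, x != 0) -> compact_isometry_group G ->
  group_reflexive G <->
  (forall f : dual X, dual_invariants G f -> norm_attaining f).
Proof.
move=> KR X0 GG; have [P [P1 gP Pg Pfix]] := averaging_projection KR GG.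
split; first exact: (norm_attaining_of_reflexive KR P1 gP Pfix X0).
exact: (reflexive_of_norm_attaining KR P1 gP Pg Pfix).
Qed.

Lemma real_real_part (R : realType) : real_part (idfun : {rmorphism R -> R}) id.
Proof.
split=> // [|X u uD uZ]; first exact: ler_norm.
by exists u => // r x y; rewrite uD uZ.
Qed.

Lemma complex_real_part (R : realType) :
  real_part (real_complex R : {rmorphism R -> R[i]%C}) (@complex.Re R).
Proof.
split.
- by move=> r s; rewrite lecR.
- by move=> [a b] [c d].
- by move=> r [a b] /=; rewrite mul0r subr0.
- by move=> [a b]; rewrite lecE /= => /andP[/eqP -> _].
- move=> [a b]; rewrite normc_def /=.
  apply: le_trans (ler_norm _) _; rewrite -sqrtr_sqr ler_sqrt ?lerDl ?sqr_ge0//.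
  by rewrite addr_ge0// sqr_ge0.
- move=> X u uD uZ.
  (* The classical complexification [u x - i u (i x)], with [j] the imaginary unit. *)
  pose j : R[i]%C := (0 +i* 1)%C.
  exists (fun x => (u x -i* u (j *: x))%C) => // -[a b] x y.
  have uj z : u ((a +i* b)%C *: z) = a * u z + b * u (j *: z).
    rewrite -!uZ -uD scalerA -scalerDl; congr (u (_ *: _)).
    by apply/eqP; rewrite eq_complex /=; apply/andP; split; apply/eqP; ring.
  have jj z : u (j *: (j *: z)) = - u z.
    rewrite scalerA -mulN1r -uZ; congr (u (_ *: _)).
    by apply/eqP; rewrite eq_complex /=; apply/andP; split; apply/eqP; ring.
  rewrite scalerDr !uD scalerA [j * _]mulrC -scalerA !uj jj.
  by apply/eqP; rewrite eq_complex /=; apply/andP; split; apply/eqP; ring.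
Qed.

Theorem theorem18 (R : realType) :
  (forall (X : completeNormedModType R) (G : set (boundedLinear X X)),
    (exists x : X, x != 0) -> compact_isometry_group G ->
    group_reflexive G <->
    (forall f : dual X, dual_invariants G f -> norm_attaining f)) /\
  (forall (X : completeNormedModType R[i]%C) (G : set (boundedLinear X X)),
    (exists x : X, x != 0) -> compact_isometry_group G ->
    group_reflexive G <->
    (forall f : dual X, dual_invariants G f -> norm_attaining f)).
Proof.
split=> X G X0 GG.
  exact: (group_james (real_real_part R) X0 GG).
exact: (group_james (complex_real_part R) X0 GG).
Qed.
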